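(* Let $\Bbbk$ be a field of characteristic zero, $n\in\mathbb N\cup\{\infty\}$ and $d\in\mathbb Z_{\ge0}$. Let $\mathcal I(n,d)$ be the two-sided ideal of negligible morphisms in $\mathbb S(n,d)$. Then $$\mathbb S(n,d)/\mathcal I(n,d)\cong S(n,d)$$ as $\Bbbk$-algebras, where $S(n,d)$ is the classical Schur algebra over $\Bbbk$.
   Context: Combinatorics (with $t\in\Bbbk$; here used for $t=d$). $\mathbb N=\{1,2,\dots\}$ and $[1,n]=\{1,\dots,n\}$ ($[1,\infty]=\mathbb N$). $\Lambda(n)_t$ is the set of sequences $\beta=(\beta_i)_{i\in[1,n]}$ with $\beta_1\in t-\mathbb Z$, $\beta_i\in\mathbb Z_{\ge 0}$ for $i\ge 2$ (all but finitely many equal to $0$), and $\sum_i\beta_i=t$. $\Lambda(n,d)$ is the set of sequences of nonnegative integers indexed by $[1,n]$ with sum $d$. The category. $\mathfrak S_\infty$ is the group of all bijections of $\Omega=\mathbb N$, with the topology in which the pointwise stabilizers of finite subsets of $\Omega$ form a base of open neighborhoods of the identity. An action of an open subgroup $U$ on a set is smooth if all point stabilizers are open. A finitary $\widehat{\mathfrak S}_\infty$-set is a set with a smooth action of some open subgroup $U\subseteq\mathfrak S_\infty$ having finitely many orbits (one may shrink $U$); a finitary $\mathfrak S_\infty$-set is a smooth $\mathfrak S_\infty$-set with finitely many orbits. Let $\mathfrak S(p)$ be the pointwise stabilizer of $\{1,\dots,p\}$. For a finitary $\widehat{\mathfrak S}_\infty$-set $X$ there is a unique polynomial $p_X\in\mathbb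 Q[T]$ with $p_X(p)=|X^{\mathfrak S(p)}|$ for all sufficiently large integers $p$; set $\mu_t(X)=p_X(t)$. If $f:X\to\Bbbk$ is constant on the orbits of such an open subgroup, put $\int_X f(x)\,dx=\sum_c c\,\mu_t(f^{-1}(c))$, the sum being over the finitely many values $c$ of $f$. The category $\operatorname{Perm}(\mathfrak S_\infty;\mu_t)$ has as objects the finitary $\mathfrak S_\infty$-sets; $\operatorname{Hom}(X,Y)$ is the space of functions $Y\times X\to\Bbbk$ constant on the diagonal $\mathfrak S_\infty$-orbits; composition is $(g\circ f)(z,x)=\int_Y g(z,y)f(y,x)\,dy$. The trace of $f\in\operatorname{End}(X)$ is $\operatorname{tr}(f)=\int_X f(x,x)\,dx$. A morphism $f:X\to Y$ is negligible if $\operatorname{tr}(f\circ g)=\operatorname{tr}(g\circ f)=0$ for all morphisms $g:Y\to X$. The algebras. For $\beta\in\Lambda(n)_t$ and $k\ge2$ let $\{\beta\}_k=[1+\sum_{i=2}^{k-1}\beta_i,\ \sum_{i=2}^{k}\beta_i]\subset\Omega$ and $\{\beta\}_1=\Omega\setminus\bigcup_{k\ge2}\{\beta\}_k$. $\mathfrak S_\beta\le\mathfrak S_\infty$ is the subgroup preserving each $\{\beta\}_k$, and $\mathcal X^\beta=\mathfrak S_\infty/\mathfrak S_\beta$. $\mathbb S(n,t)=\bigoplus_{\beta,\delta\in\Lambda(n)_t}\operatorname{Hom}_{\operatorname{Perm}(\mathfrak S_\infty;\mu_t)}(\mathcal X^\beta,\mathcal X^\delta)$, with product given by composition (zero if not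 composable). $\mathcal I(n,d)\subseteq\mathbb S(n,d)$ is the direct sum over $\beta,\delta\in\Lambda(n)_d$ of the subspaces of negligible morphisms in $\operatorname{Hom}(\mathcal X^\beta,\mathcal X^\delta)$. Classical Schur algebra. For finite $n$, $S(n,d)=\operatorname{End}_{\Bbbk\mathfrak S_d}((\Bbbk^n)^{\otimes d})$, with $\mathfrak S_d$ permuting tensor factors; equivalently $S(n,d)\cong\bigoplus_{\beta,\delta\in\Lambda(n,d)}\operatorname{Hom}_{\Bbbk\mathfrak S_d}(M^\beta,M^\delta)$, where $M^\beta$ is the permutation module on $\mathfrak S_d/\mathfrak S_\beta$ with $\mathfrak S_\beta\cong\prod_i\mathfrak S_{\beta_i}$ the Young subgroup. For $n=\infty$, $S(\infty,d)$ is defined to be this direct sum. *)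

(* Defs.v *)
From HB Require Import structures.
From mathcomp Require Import all_boot all_order all_algebra all_fingroup.
From mathcomp Require Import finmap boolp classical_sets functions cardinality.
From mathcomp Require Import fsbigop generic_quotient ring_quotient.

Set Implicit Arguments.
Unset Strict Implicit.
Unset Printing Implicit Defensive.

Import GRing.Theory.

Local Open Scope classical_set_scope.
Local Open Scope card_scope.
Local Open Scope ring_scope.

Record bilinear_product (k : fieldType) (V : lmodType k) (m : V -> V -> V) :
    Prop := BilinearProduct {
  product_linearl : forall (a : k) (u v w : V),
    m (a *: u + v) w = a *: m u w + m v w;
  product_linearr : forall (a : k) (u v w : V),
    m w (a *: u + v) = a *: m w u + m w v
}.

(* Associativity and units are not fields: they are properties of the product,
   transported by any isomorphism. *)
Structure algebra (k : fieldType) := Algebra {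
  algebra_sort :> lmodType k;
  amul : algebra_sort -> algebra_sort -> algebra_sort;
  amul_bilinear : bilinear_product amul
}.

Definition algebra_iso (k : fieldType) (A B : algebra k) : Prop :=
  exists phi : {linear A -> B},
    bijective phi /\ {morph phi : x y / amul x y}.

Definition two_sided_ideal (k : fieldType) (A : algebra k) (I : {pred A}) :
    Prop :=
  submod_closed I
  /\ (forall x y : A, y \in I -> amul x y \in I /\ amul y x \in I).

Section Quotient.
Variables (k : fieldType) (A : algebra k) (I : {pred A}).
Hypothesis hI : two_sided_ideal I.

Definition ideal_pred of two_sided_ideal I : {pred A} := I.
Local Notation J := (ideal_pred hI).

Fact ideal_pred_zmod_closed : zmod_closed J.
Proof. exact: GRing.submod_closedB (proj1 hI). Qed.

HB.instance Definition _ := GRing.isZmodClosed.Build A J ideal_pred_zmod_closed.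

Local Open Scope quotient_scope.

Definition quotient_space : Type := Quotient.quot J.
HB.instance Definition _ := GRing.Zmodule.on quotient_space.
HB.instance Definition _ := EqQuotient.on quotient_space.
HB.instance Definition _ := ZmodQuotient.on quotient_space.
Local Notation Q := quotient_space.

Definition quotient_scale (a : k) (u : Q) : Q := \pi_Q (a *: repr u).
Definition quotient_mul (u v : Q) : Q := \pi_Q (amul (repr u) (repr v)).

Lemma quotient_eqP (x y : A) : (\pi_Q x = \pi_Q y) <-> (x - y \in I).
Proof.
split=> [/eqP|h].
  by rewrite -(Quotient.idealrBE J).
by apply/eqP; rewrite -(Quotient.idealrBE J).
Qed.

Lemma quotient_reprP (x : A) : repr (\pi_Q x) - x \in I.
Proof. by apply/quotient_eqP; rewrite reprK. Qed.

Lemma ideal_lin a x y : x \in I -> y \in I -> a *: x + y \in I.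
Proof. by case: hI => -[_ +] _ => /[apply] /[apply]; apply. Qed.

Lemma ideal_0 : 0 \in I.
Proof. by case: hI => -[]. Qed.

Lemma ideal_scale a x : x \in I -> a *: x \in I.
Proof. by move=> xI; rewrite -[_ *: _]addr0 ideal_lin ?ideal_0. Qed.

Lemma ideal_add x y : x \in I -> y \in I -> x + y \in I.
Proof. by move=> xI yI; rewrite -[x]scale1r ideal_lin. Qed.

Lemma quotient_scale_pi a x : quotient_scale a (\pi_Q x) = \pi_Q (a *: x).
Proof. by apply/quotient_eqP; rewrite -scalerBr ideal_scale ?quotient_reprP. Qed.

Lemma pi_add (x y : A) : \pi_Q (x + y) = \pi_Q x + \pi_Q y.
Proof. by rewrite pi_addr. Qed.

Fact quotient_scaleA a b u :
  quotient_scale a (quotient_scale b u) = quotient_scale (a * b) u.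
Proof.
elim/quotW: u => x.
by rewrite !(quotient_scale_pi b x, quotient_scale_pi a (b *: x),
  quotient_scale_pi (a * b) x) scalerA.
Qed.

Fact quotient_scale1 : left_id 1 quotient_scale.
Proof. by move=> u; rewrite -[u]reprK quotient_scale_pi scale1r. Qed.

Fact quotient_scaleDr : right_distributive quotient_scale +%R.
Proof.
move=> a u v; rewrite -[u]reprK -[v]reprK -pi_add !quotient_scale_pi.
by rewrite scalerDr pi_add.
Qed.

Fact quotient_scaleDl u : {morph quotient_scale^~ u : a b / a + b}.
Proof.
by move=> a b /=; rewrite -[u]reprK !quotient_scale_pi scalerDl pi_add.
Qed.

HB.instance Definition _ := GRing.Zmodule_isLmodule.Build k Q
  quotient_scaleA quotient_scale1 quotient_scaleDr quotient_scaleDl.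

Lemma quotient_mul_pi x y :
  quotient_mul (\pi_Q x) (\pi_Q y) = \pi_Q (amul x y).
Proof.
apply/quotient_eqP; set x' := repr _; set y' := repr _.
have [linl linr] := amul_bilinear A.
have subl (u v w : A) : amul (u - v) w = amul u w - amul v w.
  by rewrite [u - v]addrC -[- v]scaleN1r linl scaleN1r addrC.
have subr (u v w : A) : amul w (u - v) = amul w u - amul w v.
  by rewrite [u - v]addrC -[- v]scaleN1r linr scaleN1r addrC.
have -> : amul x' y' - amul x y = amul (x' - x) y' + amul x (y' - y).
  by rewrite subl subr addrA subrK.
apply: ideal_add.
  by case: (proj2 hI y' (x' - x)) => //; exact: quotient_reprP.
by case: (proj2 hI x (y' - y)) => //; exact: quotient_reprP.
Qed.

Fact quotient_mul_bilinear : bilinear_product quotient_mul.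
Proof.
have [linl linr] := amul_bilinear A.
have pi_scale a x : a *: (\pi_Q x) = \pi_Q (a *: x) by exact: quotient_scale_pi.
split=> a u v w; rewrite -[u]reprK -[v]reprK -[w]reprK.
  by rewrite pi_scale -pi_add !quotient_mul_pi linl pi_scale -pi_add.
by rewrite pi_scale -pi_add !quotient_mul_pi linr pi_scale -pi_add.
Qed.

Definition quotient_algebra : algebra k := Algebra quotient_mul_bilinear.

End Quotient.

Definition dprod (k : fieldType) (I : Type) (V : I -> lmodType k) : Type :=
  forall i, V i.

Section DirectProduct.
Variables (k : fieldType) (I : Type) (V : I -> lmodType k).
Local Notation P := (dprod V).
Implicit Types f g h : P.

HB.instance Definition _ := gen_eqMixin P.
HB.instance Definition _ := gen_choiceMixin P.

Definition dprod_add f g : P := fun i => f i + g i.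
Definition dprod_zero : P := fun i => 0.
Definition dprod_opp f : P := fun i => - f i.
Definition dprod_scale (a : k) f : P := fun i => a *: f i.

Fact dprod_addA : associative dprod_add.
Proof. by move=> f g h; apply: functional_extensionality_dep => i; exact: addrA. Qed.
Fact dprod_addC : commutative dprod_add.
Proof. by move=> f g; apply: functional_extensionality_dep => i; exact: addrC. Qed.
Fact dprod_add0 : left_id dprod_zero dprod_add.
Proof. by move=> f; apply: functional_extensionality_dep => i; exact: add0r. Qed.
Fact dprod_addN : left_inverse dprod_zero dprod_opp dprod_add.
Proof. by move=> f; apply: functional_extensionality_dep => i; exact: addNr. Qed.

HB.instance Definition _ :=
  GRing.isZmodule.Build P dprod_addA dprod_addC dprod_add0 dprod_addN.

Fact dprod_scaleA a b f : dprod_scale a (dprod_scale b f) = dprod_scale (a * b) f.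
Proof. by apply: functional_extensionality_dep => i; exact: scalerA. Qed.
Fact dprod_scale1 : left_id 1 dprod_scale.
Proof. by move=> f; apply: functional_extensionality_dep => i; exact: scale1r. Qed.
Fact dprod_scaleDr : right_distributive dprod_scale +%R.
Proof. by move=> a f g; apply: functional_extensionality_dep => i; exact: scalerDr. Qed.
Fact dprod_scaleDl f : {morph dprod_scale^~ f : a b / a + b}.
Proof. by move=> a b; apply: functional_extensionality_dep => i; exact: scalerDl. Qed.

HB.instance Definition _ := GRing.Zmodule_isLmodule.Build k P
  dprod_scaleA dprod_scale1 dprod_scaleDr dprod_scaleDl.

Definition finitely_supported : {pred P} :=
  fun f => `[< finite_set [set i | f i != 0] >].

Fact finitely_supported_closed : submod_closed finitely_supported.
Proof.
split.
  apply/asboolP; rewrite (_ : [set i | _] = set0) ?finite_set0//.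
  by apply/seteqP; split=> i //=; rewrite eqxx.
move=> a f g /asboolP finf /asboolP fing; apply/asboolP.
apply: (@sub_finite_set _ _ ([set i | f i != 0] `|` [set i | g i != 0])).
  move=> i /= /eqP fg0; apply: contrapT => nfg; apply: fg0.
  have fi0 : f i = 0 by apply: contrapT => /eqP ?; apply: nfg; left.
  have gi0 : g i = 0 by apply: contrapT => /eqP ?; apply: nfg; right.
  by rewrite -[LHS]/(a *: f i + g i) fi0 gi0 scaler0 addr0.
by rewrite finite_setU.
Qed.

HB.instance Definition _ :=
  GRing.isSubmodClosed.Build k P finitely_supported finitely_supported_closed.

End DirectProduct.

Record dsum (k : fieldType) (I : Type) (V : I -> lmodType k) := DSum {
  dsum_val :> dprod V;
  dsum_finite : dsum_val \in @finitely_supported k I V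
}.

Section DirectSum.
Variables (k : fieldType) (I : Type) (V : I -> lmodType k).
HB.instance Definition _ := [isSub for @dsum_val k I V].
HB.instance Definition _ := [Choice of dsum V by <:].
HB.instance Definition _ := [SubChoice_isSubLmodule of dsum V by <:].
End DirectSum.

(* Only the part of a k-linear category that the algebra below refers to. *)
Structure hom_system (k : fieldType) := HomSystem {
  ob : choiceType;
  hom : ob -> ob -> lmodType k;
  hcomp : forall a b c, hom b c -> hom a b -> hom a c;
  hcomp0l : forall a b c (f : hom a b), hcomp (0 : hom b c) f = 0;
  hcomp0r : forall a b c (g : hom b c), hcomp g (0 : hom a b) = 0
}.

Section TotalAlgebra.
Variables (k : fieldType) (C : hom_system k).

Definition hom_family (i : ob C * ob C) : lmodType k := hom i.1 i.2.
Definition hom_sum := dsum hom_family.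
HB.instance Definition _ := GRing.Lmodule.on hom_sum.

(* Morphisms that are not composable multiply to zero, so the component of
   the product from a to c only sees the intermediate objects b. *)
Definition hom_sum_mul_val (g f : hom_sum) : dprod hom_family :=
  fun i => \sum_(b \in setT)
    @hcomp k C i.1 b i.2 (dsum_val g (b, i.2)) (dsum_val f (i.1, b)).

Fact hom_sum_mul_finite (g f : hom_sum) :
  hom_sum_mul_val g f \in @finitely_supported k _ hom_family.
Proof.
have /asboolP fing := dsum_finite g; have /asboolP finf := dsum_finite f.
apply/asboolP; pose G := [set i | dsum_val g i != 0].
pose F := [set i | dsum_val f i != 0].
apply: (@sub_finite_set _ _ ((fst @` F) `*` (snd @` G))); last first.
  by apply: finite_setX; exact: finite_image.
move=> [a c] /= /eqP nz0.
have [b bP] : exists b, hcomp (dsum_val g (b, c)) (dsum_val f (a, b)) <> 0.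
  apply/not_existsP => h; apply: nz0.
  rewrite /hom_sum_mul_val; apply: fsbig1 => b _.
  exact: contrapT (h b).
split.
  exists (a, b) => //; apply/eqP => f0; apply: bP.
  by rewrite [dsum_val f _]f0 hcomp0r.
exists (b, c) => //; apply/eqP => g0; apply: bP.
by rewrite [dsum_val g _]g0 hcomp0l.
Qed.

Definition hom_sum_mul (g f : hom_sum) : hom_sum :=
  DSum (hom_sum_mul_finite g f).

Lemma hom_sum_mul_bilinear :
    (forall a b c (x : k) (g g' : hom b c) (f : @hom k C a b),
      hcomp (x *: g + g') f = x *: hcomp g f + hcomp g' f) ->
    (forall a b c (x : k) (g : @hom k C b c) (f f' : hom a b),
      hcomp g (x *: f + f') = x *: hcomp g f + hcomp g f') ->
  bilinear_product hom_sum_mul.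
Proof.
move=> linl linr.
split=> x u v w; apply/val_inj; apply: functional_extensionality_dep => -[a c].
  have /asboolP finw := dsum_finite w.
  pose X := fset_set (snd @` [set i | dsum_val w i != 0]).
  have w0 b : b \notin X -> dsum_val w (a, b) = 0.
    rewrite in_fset_set; last exact: finite_image.
    by move=> /negP nX; apply: contrapT => /eqP nz; apply: nX; rewrite inE; exists (a, b).
  rewrite /= -[RHS]/(x *: hom_sum_mul_val u w (a, c) + hom_sum_mul_val v w (a, c)).
  rewrite /hom_sum_mul_val/= !(fsbigTE X); try by move=> b /w0 ->; rewrite hcomp0r.
  by rewrite scaler_sumr -big_split/=; apply: eq_bigr => b _; rewrite -linl.
have /asboolP finw := dsum_finite w.
pose X := fset_set (fst @` [set i | dsum_val w i != 0]).
have w0 b : b \notin X -> dsum_val w (b, c) = 0.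
  rewrite in_fset_set; last exact: finite_image.
  by move=> /negP nX; apply: contrapT => /eqP nz; apply: nX; rewrite inE; exists (b, c).
rewrite /= -[RHS]/(x *: hom_sum_mul_val w u (a, c) + hom_sum_mul_val w v (a, c)).
rewrite /hom_sum_mul_val/= !(fsbigTE X); try by move=> b /w0 ->; rewrite hcomp0l.
by rewrite scaler_sumr -big_split/=; apply: eq_bigr => b _; rewrite -linr.
Qed.

End TotalAlgebra.

(* The set {1, 2, 3, ...} is encoded by nat, x standing for x + 1: hence
   [1, p] becomes `I_p = [set x | x < p]. *)
Record symN := SymN {
  sym_fun :> nat -> nat;
  sym_inv : nat -> nat;
  sym_funK : cancel sym_fun sym_inv;
  sym_invK : cancel sym_inv sym_fun
}.

HB.instance Definition _ := gen_eqMixin symN.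
HB.instance Definition _ := gen_choiceMixin symN.

Lemma symN_eq (g h : symN) : (forall x, g x = h x) -> g = h.
Proof.
case: g h => [g g' gK g'K] [h h' hK h'K] /= gh.
have {}gh : g = h by exact: funext.
subst h; have gh' : g' = h'.
  by apply: funext => x; rewrite -[in LHS](h'K x) gK.
by subst h'; congr SymN; exact: Prop_irrelevance.
Qed.

Definition symN_one : symN := @SymN id id (fun=> erefl) (fun=> erefl).
Definition symN_inv (g : symN) : symN := SymN (@sym_invK g) (@sym_funK g).
Definition symN_mul (g h : symN) : symN :=
  @SymN (g \o h) (sym_inv h \o sym_inv g)
    (can_comp (@sym_funK g) (@sym_funK h))
    (can_comp (@sym_invK h) (@sym_invK g)).

Fact symN_mulA : associative symN_mul.
Proof. by move=> f g h; exact: symN_eq. Qed.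
Fact symN_mul1 : left_id symN_one symN_mul.
Proof. by move=> g; exact: symN_eq. Qed.
Fact symN_mulr1 : right_id symN_one symN_mul.
Proof. by move=> g; exact: symN_eq. Qed.
Fact symN_mulV : left_inverse symN_one symN_inv symN_mul.
Proof. by move=> g; apply: symN_eq => x /=; rewrite sym_funK. Qed.
Fact symN_mulrV : right_inverse symN_one symN_inv symN_mul.
Proof. by move=> g; apply: symN_eq => x /=; rewrite sym_invK. Qed.

HB.instance Definition _ :=
  isGroup.Build symN symN_mulA symN_mul1 symN_mulr1 symN_mulV symN_mulrV.

Definition pointwise_stab (A : set nat) : set symN :=
  [set g | forall x, A x -> g x = x].

Definition stab_upto (p : nat) : set symN := pointwise_stab `I_p.

(* Open for the group topology in which the pointwise stabilizers of finite
   sets form a base of neighborhoods of 1. *)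
Definition open_symN (U : set symN) : Prop :=
  forall g, U g -> exists2 A : set nat, finite_set A &
    forall h, pointwise_stab A h -> U (g * h)%g.

Structure finitary_set := FinitarySet {
  fin_carrier :> Type;
  fin_act : symN -> fin_carrier -> fin_carrier;
  fin_act1 : forall x, fin_act 1%g x = x;
  fin_actM : forall g h x, fin_act (g * h)%g x = fin_act g (fin_act h x);
  fin_smooth : forall x, open_symN [set g | fin_act g x = x];
  fin_orbits : exists2 R : set fin_carrier, finite_set R &
    forall x, exists2 r, R r & exists g, x = fin_act g r
}.

(* Z is a subset of X, stable under some open subgroup: the finitary sets that
   are integrated over are the level sets of functions on an object. *)
Definition fixed_points (X : finitary_set) (Z : set X) (p : nat) : set X :=
  Z `&` [set x | forall g, stab_upto p g -> fin_act g x = x].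

Definition counting_polynomial (X : finitary_set) (Z : set X) :
    set {poly rat} :=
  [set P | exists p0, forall p, (p0 <= p)%N ->
     exists2 m, fixed_points Z p #= `I_m & P.[p%:R] = m%:R].

Definition mu (k : fieldType) (t : k) (X : finitary_set) (Z : set X) : k :=
  (map_poly ratr (xget 0 (counting_polynomial Z))).[t].

Definition integral (k : fieldType) (t : k) (X : finitary_set) (f : X -> k) :
    k :=
  \sum_(c \in range f) c * mu t (f @^-1` [set c]).

Definition transp (a b x : nat) : nat :=
  if x == a then b else if x == b then a else x.

Lemma transpK a b : involutive (transp a b).
Proof.
move=> x; rewrite /transp; case: (eqVneq x a) => [->|xa].
  by rewrite eqxx; case: eqVneq.
by case: (eqVneq x b) => [->|xb]; rewrite ?eqxx// (negPf xa) (negPf xb).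
Qed.

Definition symN_transp a b : symN := SymN (transpK a b) (transpK a b).

Lemma finitary_approx (h : symN) (q : nat) :
  exists2 h' : symN, (forall x, (x < q)%N -> h' x = h x) &
    exists N, forall x, (N <= x)%N -> h' x = x.
Proof.
elim: q => [|q [h' hh' [N hN]]].
  by exists 1%g => //; exists 0%N.
exists (symN_transp (h' q) (h q) * h')%g.
  move=> x; rewrite ltnS leq_eqVlt => /orP[/eqP->|xq] /=.
    by rewrite /transp eqxx.
  have xneq : x != q by rewrite neq_ltn xq.
  rewrite /transp; case: eqP => [|_].
    by move=> /(can_inj (@sym_funK h'))/eqP; rewrite (negPf xneq).
  rewrite hh'//; case: eqP => // /(can_inj (@sym_funK h))/eqP.
  by rewrite (negPf xneq).
exists (maxn N (maxn (h' q) (h q)).+1) => x.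
rewrite !geq_max => /andP[Nx]; rewrite gtn_max => /andP[x1 x2] /=.
by rewrite (hN x Nx) /transp !gtn_eqF.
Qed.

Section Invariance.
Variable X : finitary_set.
Implicit Types (Z : set X) (g h : symN).

Lemma fin_actK g : cancel (@fin_act X g) (fin_act g^-1%g).
Proof. by move=> x; rewrite -fin_actM mulVg fin_act1. Qed.

Lemma fin_actVK g : cancel (@fin_act X g^-1%g) (fin_act g).
Proof. by move=> x; rewrite -fin_actM mulgV fin_act1. Qed.

Lemma counting_polynomial_act Z q h :
    (forall g x, stab_upto q g -> Z x -> Z (fin_act g x)) ->
  counting_polynomial (fin_act h @` Z) = counting_polynomial Z.
Proof.
move=> Zq; have [h' hh' [N hN]] := finitary_approx h q.
have s_stab : stab_upto q (h^-1 * h')%g.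
  by move=> x /= xq; rewrite hh'// sym_funK.
have s'_stab : stab_upto q (h'^-1 * h)%g.
  by move=> x /= xq; rewrite -hh'// sym_funK.
have -> : fin_act h @` Z = fin_act h' @` Z.
  apply/seteqP; split=> _ [x Zx <-].
    exists (fin_act (h'^-1 * h)%g x); first exact: Zq.
    by rewrite fin_actM fin_actVK.
  exists (fin_act (h^-1 * h')%g x); first exact: Zq.
  by rewrite fin_actM fin_actVK.
have fixE p : (N <= p)%N ->
    fixed_points (fin_act h' @` Z) p #= fixed_points Z p.
  move=> Np; suff -> : fixed_points (fin_act h' @` Z) p =
      fin_act h' @` fixed_points Z p.
    apply: inj_card_eq; apply: in2W; apply: can_inj; exact: fin_actK.
  have h'lt x : (x < p)%N -> (h' x < p)%N.
    move=> xp; rewrite ltnNge; apply/negP => px.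
    have /(can_inj (@sym_funK h')) h'x := hN _ (leq_trans Np px).
    by move: px; rewrite h'x leqNgt xp.
  have h'Vlt x : (x < p)%N -> (sym_inv h' x < p)%N.
    move=> xp; rewrite ltnNge; apply/negP => px.
    have := hN _ (leq_trans Np px); rewrite sym_invK => h'x.
    by move: px; rewrite -h'x leqNgt xp.
  have conj g : stab_upto p g -> stab_upto p (h' * g * h'^-1)%g.
    by move=> gp x /= xp; rewrite gp ?sym_invK//; exact: h'Vlt.
  have conjV g : stab_upto p g -> stab_upto p (h'^-1 * g * h')%g.
    by move=> gp x /= xp; rewrite gp ?sym_funK//; exact: h'lt.
  apply/seteqP; split=> [_ [[x Zx <-] fx]|_ [x [Zx fx] <-]].
    exists x => //; split=> // g gp; apply: (can_inj (fin_actK h')).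
    rewrite -[RHS](fx _ (conj _ gp)) -!fin_actM; congr fin_act.
    by rewrite -!mulgA mulVg mulg1.
  split; first by exists x.
  move=> g gp; rewrite -[in RHS](fx _ (conjV _ gp)) -!fin_actM.
  by congr fin_act; rewrite !mulgA mulgV mul1g.
apply/seteqP; split=> P [p0 Pp0]; exists (maxn p0 N) => p; rewrite geq_max.
  move=> /andP[p0p Np]; have [m cm Pm] := Pp0 _ p0p; exists m => //.
  by apply: card_eq_trans cm; rewrite card_eq_sym fixE.
move=> /andP[p0p Np]; have [m cm Pm] := Pp0 _ p0p; exists m => //.
by apply: card_eq_trans cm; rewrite fixE.
Qed.

Lemma integral_act (k : fieldType) (t : k) (f : X -> k) q h :
    (forall g x, stab_upto q g -> f (fin_act g x) = f x) ->
  integral t (fun x => f (fin_act h^-1%g x)) = integral t f.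
Proof.
move=> fq; rewrite /integral.
have -> : range (fun x => f (fin_act h^-1%g x)) = range f.
  apply/seteqP; split=> _ [x _ <-]; first by exists (fin_act h^-1%g x).
  by exists (fin_act h x) => //; rewrite fin_actK.
apply: eq_fsbigr => c _; congr (_ * _).
rewrite /mu -(@counting_polynomial_act (f @^-1` [set c]) q h); last first.
  by move=> g x gq /=; rewrite fq.
congr (map_poly _ (xget _ (counting_polynomial _))).[_].
apply/seteqP; split=> [x /= fx|_ [x /= fx <-]]; last by rewrite /= fin_actK.
by exists (fin_act h^-1%g x) => //; rewrite fin_actVK.
Qed.

Lemma integral0 (k : fieldType) (t : k) : integral t (fun _ : X => 0 : k) = 0.
Proof. by apply: fsbig1 => _ [x _ <-]; rewrite mul0r. Qed.

Lemma fin_stab_upto (x : X) : exists q, forall p g, (q <= p)%N ->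
  stab_upto p g -> fin_act g x = x.
Proof.
have [A /finite_seqP[s As] sA] := @fin_smooth X x 1%g (fin_act1 x).
exists (\max_(i <- s) i).+1 => p g qp gp.
rewrite -[RHS](sA g) ?mul1g//= => i Ai; apply: gp => /=.
apply: leq_trans qp; rewrite ltnS.
by apply: (@leq_bigmax_seq _ _ xpredT id) => //; move: Ai; rewrite As.
Qed.

End Invariance.

Section Perm.
Variables (k : fieldType).

Section Hom.
Variables (X Y : finitary_set).

Definition orbit_constant : {pred Y * X -> k^o} := fun f =>
  `[< forall g y x, f (fin_act g y, fin_act g x) = f (y, x) >].

Fact orbit_constant_closed : submod_closed orbit_constant.
Proof.
split; first exact/asboolP.
move=> a f g /asboolP fc /asboolP gc; apply/asboolP => h y x.
by rewrite !addrfctE !scalrfctE fc gc.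
Qed.

HB.instance Definition _ := GRing.isSubmodClosed.Build k (Y * X -> k^o)
  orbit_constant orbit_constant_closed.

(* As for matrices, a morphism from X to Y is a function on Y * X. *)
Record perm_hom := PermHom {
  perm_hom_fun :> Y * X -> k^o;
  perm_homP : perm_hom_fun \in orbit_constant
}.

HB.instance Definition _ := [isSub for perm_hom_fun].
HB.instance Definition _ := [Choice of perm_hom by <:].
HB.instance Definition _ := [SubChoice_isSubLmodule of perm_hom by <:].

End Hom.

Variable t : k.

Definition perm_comp_val (X Y Z : finitary_set) (g : perm_hom Y Z)
    (f : perm_hom X Y) : Z * X -> k^o :=
  fun zx => integral t (fun y => g (zx.1, y) * f (y, zx.2) : k).

Fact perm_comp_constant X Y Z (g : perm_hom Y Z) (f : perm_hom X Y) :
  perm_comp_val g f \in @orbit_constant X Z.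
Proof.
apply/asboolP => h z x; rewrite /perm_comp_val/=.
have /asboolP gc := perm_homP g; have /asboolP fc := perm_homP f.
have [q1 q1z] := fin_stab_upto z; have [q2 q2x] := fin_stab_upto x.
rewrite -[RHS](@integral_act _ _ _ _ (maxn q1 q2) h).
  congr integral; apply: funext => y.
  by rewrite -[in RHS](gc h z) -[in RHS](fc h _ x) fin_actVK.
move=> s y sq.
rewrite -{1}(q1z _ _ (leq_maxl _ _) sq) gc.
by rewrite -{1}(q2x _ _ (leq_maxr _ _) sq) fc.
Qed.

Definition perm_comp X Y Z (g : perm_hom Y Z) (f : perm_hom X Y) :
  perm_hom X Z := PermHom (perm_comp_constant g f).

Definition perm_trace (X : finitary_set) (f : perm_hom X X) : k :=
  integral t (fun x => f (x, x) : k).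

Definition negligible (X Y : finitary_set) (f : perm_hom X Y) : Prop :=
  forall g : perm_hom Y X,
    perm_trace (perm_comp f g) = 0 /\ perm_trace (perm_comp g f) = 0.

Lemma perm_comp0l X Y Z (f : perm_hom X Y) :
  perm_comp (0 : perm_hom Y Z) f = 0.
Proof.
apply/val_inj/funext => -[z x]; rewrite /= /perm_comp_val -[RHS](integral0 Y t).
by congr integral; apply: funext => y; rewrite [_ (_, _)](_ : _ = 0)// mul0r.
Qed.

Lemma perm_comp0r X Y Z (g : perm_hom Y Z) :
  perm_comp g (0 : perm_hom X Y) = 0.
Proof.
apply/val_inj/funext => -[z x]; rewrite /= /perm_comp_val -[RHS](integral0 Y t).
congr integral; apply: funext => y.
by rewrite [in X in _ * X](_ : _ (_, _) = 0)// mulr0.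
Qed.

End Perm.

(* [1, n], where None stands for n = oo. *)
Definition in_range (n : option nat) (i : nat) : bool :=
  (0 < i)%N && (if n is Some m then (i <= m)%N else true).

(* A weight is a pair (b_1, (b_i)_(i >= 2)): only the first entry may fail to
   be a natural number. The values at 0 and 1 of the second component are not
   entries of the sequence, and are set to 0. *)
Definition is_weight (k : fieldType) (n : option nat) (t : k)
    (b : k * (nat -> nat)) : Prop :=
  [/\ exists m : int, b.1 = t - m%:~R,
      forall i, b.2 i != 0 -> (2 <= i)%N && in_range n i,
      finite_set [set i | b.2 i != 0]
    & b.1 + \sum_(i \in setT) ((b.2 i)%:R : k) = t].

Definition weight (k : fieldType) (n : option nat) (t : k) : choiceType :=
  {b : k * (nat -> nat) | `[< is_weight n t b >]}.

Section InfiniteBlocks.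
Variables (k : fieldType) (n : option nat) (t : k).
Implicit Type b : weight n t.

Definition tail b : nat -> nat := (val b).2.

(* See symN for the shift by 1. *)
Definition tail_block b (i : nat) : set nat :=
  [set x | (\sum_(2 <= j < i) tail b j <= x < \sum_(2 <= j < i.+1) tail b j)%N].

Definition block b (i : nat) : set nat :=
  if i == 1%N then ~` \bigcup_(j in [set j | (2 <= j)%N]) tail_block b j
  else tail_block b i.

Definition young b : set symN :=
  [set g | forall i, in_range n i -> g @` block b i = block b i].

Lemma young1 b : young b 1%g.
Proof. by move=> i _; rewrite image_id. Qed.

Lemma youngM b g h : young b g -> young b h -> young b (g * h)%g.
Proof.
by move=> gb hb i ni; rewrite -[RHS](gb i ni) -[in RHS](hb i ni) -image_comp.
Qed.

Lemma youngV b g : young b g -> young b g^-1%g.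
Proof.
move=> gb i ni; rewrite -[in LHS](gb i ni) image_comp.
apply/seteqP; split=> [_ [x bx <-]|x bx] /=; first by rewrite sym_funK.
by exists x => //=; rewrite sym_funK.
Qed.

Lemma young_open b : exists N, forall g, stab_upto N g -> young b g.
Proof.
have /asboolP[_ _ /finite_seqP[s bs] _] := valP b.
pose M := (\max_(i <- s) i).+1.
exists (\sum_(2 <= j < M) tail b j)%N => g gN.
have tail0 j : (M <= j)%N -> tail b j = 0%N.
  move=> Mj; apply/eqP/negPn/negP => nz.
  have js : j \in s by have : [set i | tail b i != 0%N] j by []; rewrite /tail bs.
  by move: Mj; rewrite ltnNge (@leq_bigmax_seq _ _ xpredT id).
have leN i : (\sum_(2 <= j < i) tail b j <= \sum_(2 <= j < M) tail b j)%N.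
  have [iM|Mi] := leqP i M.
    have [i2|i2] := leqP 2 i; last by rewrite big_geq// ltnW.
    by rewrite [leqRHS](big_cat_nat i2 iM)/= leq_addr.
  have [M2|M2] := leqP 2 M.
    rewrite (big_cat_nat M2 (ltnW Mi))/= [X in (_ + X)%N]big1_seq ?addn0//.
    by move=> j /andP[_]; rewrite mem_index_iota => /andP[Mj _]; exact: tail0.
  rewrite big1_seq// => j; rewrite mem_index_iota => /andP[_ /andP[j2 _]].
  by apply: tail0; rewrite (leq_trans (ltnW M2)).
have gfix i x : tail_block b i x -> g x = x.
  by move=> /andP[_ xi]; apply: gN; apply: leq_trans xi (leN _).
have gVfix i x : tail_block b i x -> sym_inv g x = x.
  by move=> /gfix {1}<-; rewrite sym_funK.
move=> i _; rewrite /block; case: ifPn => _.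
  apply/seteqP; split=> [_ [x nx <-] [j j2 bj]|x nx].
    apply: nx; exists j => //; suff <- : g x = x by [].
    by rewrite -[RHS](sym_funK g) (gVfix _ _ bj).
  exists (sym_inv g x); last by rewrite sym_invK.
  by move=> [j j2 bj]; apply: nx; exists j; rewrite // -(sym_invK g x) (gfix _ _ bj).
apply/seteqP; split=> [_ [x bx <-]|x bx]; first by rewrite (gfix _ _ bx).
by exists x => //; exact: gfix bx.
Qed.

End InfiniteBlocks.

Section CosetSpace.
Variables (k : fieldType) (n : option nat) (t : k) (b : weight n t).

Definition left_coset (g : symN) : set symN := [set (g * s)%g | s in young b].

Record coset_space := CosetSpace {
  coset_val : set symN;
  cosetP : exists g, coset_val = left_coset g
}.

Lemma coset_eq (C D : coset_space) : coset_val C = coset_val D -> C = D.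
Proof.
case: C D => [C hC] [D hD] /= CD; subst D.
by congr CosetSpace; exact: Prop_irrelevance.
Qed.

Fact coset_actP (h : symN) (C : coset_space) :
  exists g, [set (h * x)%g | x in coset_val C] = left_coset g.
Proof.
have [g ->] := cosetP C; exists (h * g)%g; rewrite /left_coset image_comp.
by apply: eq_imagel => x _ /=; rewrite mulgA.
Qed.

Definition coset_act (h : symN) (C : coset_space) : coset_space :=
  CosetSpace (coset_actP h C).

Fact coset_act1 C : coset_act 1%g C = C.
Proof.
apply: coset_eq => /=; rewrite -[RHS]image_id.
by apply: eq_imagel => x _ /=; rewrite mul1g.
Qed.

Fact coset_actM g h C : coset_act (g * h)%g C = coset_act g (coset_act h C).
Proof.
apply: coset_eq => /=; rewrite image_comp.
by apply: eq_imagel => x _ /=; rewrite mulgA.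
Qed.

Fact coset_smooth C : open_symN [set g | coset_act g C = C].
Proof.
move=> g /= gC; have [f Cf] := cosetP C; have [N bN] := young_open b.
exists (f @` `I_N); first exact/finite_image/finite_II.
move=> h hf; rewrite coset_actM; suff -> : coset_act h C = C by [].
have hb : young b (f^-1 * h * f)%g.
  by apply: bN => x xN /=; rewrite hf ?sym_funK//; exists x.
apply: coset_eq; rewrite /= Cf /left_coset image_comp.
apply/seteqP; split=> [_ [s bs <-]|_ [s bs <-]] /=.
  exists (f^-1 * h * f * s)%g; first exact: youngM.
  by rewrite !mulgA mulgV mul1g.
exists ((f^-1 * h * f)^-1 * s)%g; first exact/youngM/bs/youngV.
by rewrite !invMg invgK !mulgA mulgK mulgV mul1g.
Qed.

Fact coset_orbits : exists2 R : set coset_space, finite_set R &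
  forall C, exists2 D, R D & exists g, C = coset_act g D.
Proof.
pose D := CosetSpace (ex_intro _ 1%g (erefl (left_coset 1%g))).
exists [set D] => // C; exists D => //; have [g Cg] := cosetP C; exists g.
apply: coset_eq; rewrite /= Cg /left_coset image_comp.
by apply: eq_imagel => s _ /=; rewrite mul1g.
Qed.

Definition coset_set : finitary_set :=
  FinitarySet coset_act1 coset_actM coset_smooth coset_orbits.

End CosetSpace.

Definition perm_system (k : fieldType) (n : option nat) (t : k) :
    hom_system k :=
  @HomSystem k (weight n t)
    (fun b c => perm_hom k (coset_set b) (coset_set c) : lmodType k)
    (fun b c e g f => perm_comp t g f)
    (fun b c e f => perm_comp0l t _ f)
    (fun b c e g => perm_comp0r t _ g).

Definition inf_schur (k : fieldType) (n : option nat) (t : k) : lmodType k :=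
  hom_sum (perm_system n t).

Definition inf_schur_mul (k : fieldType) (n : option nat) (t : k) :
    inf_schur n t -> inf_schur n t -> inf_schur n t :=
  @hom_sum_mul k (perm_system n t).

Definition negligible_ideal (k : fieldType) (n : option nat) (t : k) :
    {pred inf_schur n t} :=
  fun x => `[< forall b c : weight n t,
    negligible t (dsum_val x (b, c) : perm_hom k (coset_set b) (coset_set c)) >].

Section PermutationModules.
Variables (k : fieldType) (d : nat).

Definition perm_module (X : finType) : vectType k := {ffun X -> k^o}.

(* MathComp composes permutations from left to right, so that left actions of
   the symmetric group are right actions of 'S_d. The basis vector at x is
   sent by s to the basis vector at to x s. *)
Definition perm_module_act (X : finType) (to : {action 'S_d &-> X}) (s : 'S_d)
    (v : perm_module X) : perm_module X :=
  [ffun x => v (to x s^-1%g)].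

Section EquivariantMaps.
Variables (X Y : finType) (toX : {action 'S_d &-> X}) (toY : {action 'S_d &-> Y}).

Definition equivariant : {pred 'Hom(perm_module X, perm_module Y)} :=
  fun f => `[< forall s v,
    f (perm_module_act toX s v) = perm_module_act toY s (f v) >].

Fact equivariant_closed : submod_closed equivariant.
Proof.
split.
  by apply/asboolP => s v; apply/ffunP => y; rewrite !ffunE !lfunE/= !ffunE.
move=> a f g /asboolP fe /asboolP ge; apply/asboolP => s v.
by rewrite !lfunE/= !lfunE/= fe ge; apply/ffunP => y; rewrite !ffunE.
Qed.

HB.instance Definition _ := GRing.isSubmodClosed.Build k
  'Hom(perm_module X, perm_module Y) equivariant equivariant_closed.

Record equi_hom := EquiHom {
  equi_hom_val :> 'Hom(perm_module X, perm_module Y);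
  equi_homP : equi_hom_val \in equivariant
}.

HB.instance Definition _ := [isSub for equi_hom_val].
HB.instance Definition _ := [Choice of equi_hom by <:].
HB.instance Definition _ := [SubChoice_isSubLmodule of equi_hom by <:].

End EquivariantMaps.

Section Composition.
Variables (X Y Z : finType).
Variables (toX : {action 'S_d &-> X}) (toY : {action 'S_d &-> Y}).
Variable toZ : {action 'S_d &-> Z}.

Fact equi_comp_equivariant (g : equi_hom toY toZ) (f : equi_hom toX toY) :
  (g \o f)%VF \in equivariant toX toZ.
Proof.
have /asboolP ge := equi_homP g; have /asboolP fe := equi_homP f.
by apply/asboolP => s v; rewrite !lfunE/= fe ge.
Qed.

Definition equi_comp (g : equi_hom toY toZ) (f : equi_hom toX toY) :
  equi_hom toX toZ := EquiHom (equi_comp_equivariant g f).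

Lemma equi_compl (a : k) (g g' : equi_hom toY toZ) (f : equi_hom toX toY) :
  equi_comp (a *: g + g') f = a *: equi_comp g f + equi_comp g' f.
Proof. by apply/val_inj; rewrite /= comp_lfunDl comp_lfunZl. Qed.

Lemma equi_compr (a : k) (g : equi_hom toY toZ) (f f' : equi_hom toX toY) :
  equi_comp g (a *: f + f') = a *: equi_comp g f + equi_comp g f'.
Proof. by apply/val_inj; rewrite /= comp_lfunDr comp_lfunZr. Qed.

Lemma equi_comp0l (f : equi_hom toX toY) : equi_comp 0 f = 0.
Proof. by apply/val_inj; rewrite /= comp_lfun0l. Qed.

Lemma equi_comp0r (g : equi_hom toY toZ) : equi_comp g 0 = 0.
Proof. by apply/val_inj; rewrite /= comp_lfun0r. Qed.

End Composition.

Definition equi_end (X : finType) (to : {action 'S_d &-> X}) : algebra k :=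
  @Algebra k (equi_hom to to) (@equi_comp _ _ _ to to to)
    (BilinearProduct (@equi_compl _ _ _ to to to)
      (fun a f f' g => equi_compr a g f f')).

End PermutationModules.

Section TensorPower.
Variables (m d : nat).

(* The pure tensors e_(w 1) # ... # e_(w d) form a basis of the d-th tensor
   power of k^m, which is thus the permutation module on the words w. *)
Definition words : finType := {ffun 'I_d -> 'I_m}.

Definition place_perm (w : words) (s : 'S_d) : words := [ffun i => w (s^-1%g i)].

Fact place_perm1 w : place_perm w 1%g = w.
Proof. by apply/ffunP => i; rewrite ffunE invg1 perm1. Qed.

Fact place_permM w s u : place_perm w (s * u)%g = place_perm (place_perm w s) u.
Proof. by apply/ffunP => i; rewrite !ffunE invMg permM. Qed.

Definition place_action : {action 'S_d &-> words} :=
  TotalAction place_perm1 place_permM.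

End TensorPower.

Definition schur_end (k : fieldType) (m d : nat) : algebra k :=
  equi_end k (place_action m d).

Definition is_composition (n : option nat) (d : nat) (b : nat -> nat) : Prop :=
  [/\ forall i, b i != 0%N -> in_range n i,
      finite_set [set i | b i != 0%N]
    & \sum_(i \in setT) b i = d].

Definition composition (n : option nat) (d : nat) : choiceType :=
  {b : nat -> nat | `[< is_composition n d b >]}.

Section FiniteBlocks.
Variables (n : option nat) (d : nat) (b : composition n d).

(* As before, the elements of {1, ..., d} are shifted by 1. *)
Definition fin_block (i : nat) : {set 'I_d} :=
  [set x : 'I_d |
    (\sum_(1 <= j < i) val b j <= x < \sum_(1 <= j < i.+1) val b j)%N]%SET.

Definition fin_young_set : {set 'S_d} :=
  [set s : 'S_d | `[< forall i, in_range n i ->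
    (s @: fin_block i = fin_block i)%SET >] ]%SET.

Fact fin_young_group_set : group_set fin_young_set.
Proof.
apply/group_setP; split.
  rewrite inE; apply/asboolP => i _.
  by rewrite -[RHS]imset_id; apply: eq_imset => x; rewrite perm1.
move=> s u; rewrite !inE => /asboolP sb /asboolP ub; apply/asboolP => i ni.
rewrite -[RHS](ub i ni) -[in RHS](sb i ni) -imset_comp.
by apply: eq_imset => x; rewrite permM.
Qed.

Definition fin_young : {group 'S_d} := Group fin_young_group_set.

(* S_d / S_b; see perm_module_act for the order of composition. *)
Definition fin_coset : finType :=
  {C : {set 'S_d} | C \in rcosets fin_young [set: 'S_d]%SET}.

Fact fin_coset_actP (C : fin_coset) (s : 'S_d) :
  (val C :* s)%g \in rcosets fin_young [set: 'S_d]%SET.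
Proof.
have /rcosetsP[u _ ->] := valP C.
by rewrite -rcosetM; apply/rcosetsP; exists (u * s)%g; rewrite ?inE.
Qed.

Definition fin_coset_act (C : fin_coset) (s : 'S_d) : fin_coset :=
  Sub (val C :* s)%g (fin_coset_actP C s).

Fact fin_coset_act1 C : fin_coset_act C 1%g = C.
Proof. by apply/val_inj; rewrite /= rcoset1. Qed.

Fact fin_coset_actM C s u :
  fin_coset_act C (s * u)%g = fin_coset_act (fin_coset_act C s) u.
Proof. by apply/val_inj; rewrite /= rcosetM. Qed.

Definition fin_coset_action : {action 'S_d &-> fin_coset} :=
  TotalAction fin_coset_act1 fin_coset_actM.

End FiniteBlocks.

Definition young_system (k : fieldType) (n : option nat) (d : nat) :
    hom_system k :=
  @HomSystem k (composition n d)
    (fun b c => equi_hom k (fin_coset_action b) (fin_coset_action c) :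
      lmodType k)
    (fun b c e g f => equi_comp g f)
    (fun b c e f => equi_comp0l _ f)
    (fun b c e g => equi_comp0r _ g).

Definition schur_sum (k : fieldType) (n : option nat) (d : nat) : algebra k :=
  @Algebra k (hom_sum (young_system k n d)) (@hom_sum_mul k (young_system k n d))
    (@hom_sum_mul_bilinear k (young_system k n d)
      (fun b c e x g g' f => equi_compl x g g' f)
      (fun b c e x g f f' => equi_compr x g f f')).

Definition classical_schur (k : fieldType) (n : option nat) (d : nat) :
    algebra k :=
  if n is Some m then schur_end k m d else schur_sum k None d.

(* The product is defined without knowing that counting polynomials exist, but
   its bilinearity depends on it: hence the argument h. *)
Definition inf_schur_algebra (k : fieldType) (n : option nat) (t : k)
    (h : bilinear_product (@inf_schur_mul k n t)) : algebra k :=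
  Algebra h.

(* Main.v *)
(* A coset of the Young subgroup of a weight b is a word: a colouring of nat in
   which all but finitely many places have the colour 1 and each colour i >= 2
   occurs b_i times. The cosets fixed by the stabilizer of the first p places
   are the words that are trivial from place p on. If f is invariant under the
   stabilizer of the first q places, the sum of f over the words that are
   trivial from p on is, for all p >= q and not merely for large p, a polynomial
   in p: grouping words by the set of their nontrivial places in [q, p[, it is a
   combination of the binomial coefficients C(p - q, s). Hence for t = d >= q the
   integral of f is the sum of its values at the words trivial from d on, so
   that restriction to these words is a functor to matrices indexed by words of
   length d, with values in the matrices invariant under S_d, and it preserves
   traces. It is full because pairs of such words that are conjugate under
   symN are already conjugate under S_d, and its kernel consists of the negligible
   morphisms: in characteristic 0 the trace of a nonzero invariant matrix with
   the transposed indicator of some S_d-orbit is nonzero. The matrices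
   reached are those of the classical Schur algebra. *)
From HB Require Import structures.
Require Import Defs.
From mathcomp Require Import all_boot all_order all_algebra all_fingroup.
From mathcomp Require Import finmap boolp classical_sets functions cardinality.
From mathcomp Require Import fsbigop ring generic_quotient zify.

Set Implicit Arguments.
Unset Strict Implicit.
Unset Printing Implicit Defensive.

Import GRing.Theory.
Local Open Scope classical_set_scope.
Local Open Scope card_scope.
Local Open Scope ring_scope.

(** * Words and permutations *)

Definition letters (T : Type) (w : nat -> T) (p : nat) : seq T :=
  [seq w x | x <- iota 0 p].

Lemma lettersE (T : Type) (w : nat -> T) (p : nat) :
  letters w p = [seq w (val i) | i <- enum 'I_p].
Proof. by rewrite /letters -val_enum_ord -map_comp. Qed.

(** The letters other than [c0] form permuted subsequences, and equal lengths then fix the number of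
    [c0]. This suits the colour 1, whose multiplicity among the first p places is not an entry of
    the tail of a weight. *)
Lemma perm_eq_except1 (T : eqType) (c0 : T) (s1 s2 : seq T) :
    size s1 = size s2 ->
    (forall c, c != c0 -> count_mem c s1 = count_mem c s2) ->
  perm_eq s1 s2.
Proof.
move=> s12 cnt; apply/allP => c _ /=; apply/eqP.
have [->|] := eqVneq c c0; last exact: cnt.
suff: count (predC (pred1 c0)) s1 = count (predC (pred1 c0)) s2.
  by have := count_predC (pred1 c0) s1; have := count_predC (pred1 c0) s2; lia.
rewrite -!size_filter; apply: perm_size; apply/allP => a _ /=.
rewrite !count_filter; have [->|ac] := eqVneq a c0.
  by rewrite !(eq_count (a2 := pred0)) ?count_pred0// => x /=; case: eqP.
rewrite !(eq_count (a2 := pred1 a)); first exact/eqP/cnt.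
- by move=> x /=; case: eqVneq => //= ->; rewrite ac.
- by move=> x /=; case: eqVneq => //= ->; rewrite ac.
Qed.

Section OrdinalPermutations.
Variable p : nat.

Definition perm_nat (s : 'S_p) (x : nat) : nat :=
  oapp (fun i : 'I_p => val (s i)) x (insub x).

Lemma perm_nat_ord s (i : 'I_p) : perm_nat s i = s i.
Proof. by rewrite /perm_nat valK. Qed.

Lemma perm_nat_ge s x : (p <= x)%N -> perm_nat s x = x.
Proof. by move=> px; rewrite /perm_nat insubF// ltnNge px. Qed.

Lemma perm_natM s u x : perm_nat (s * u)%g x = perm_nat u (perm_nat s x).
Proof.
have [xp|px] := ltnP x p; last by rewrite !perm_nat_ge.
by rewrite -[x]/(val (Ordinal xp)) !perm_nat_ord permM.
Qed.

Lemma perm_nat1 x : perm_nat 1%g x = x.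
Proof.
have [xp|px] := ltnP x p; last by rewrite perm_nat_ge.
by rewrite -[x]/(val (Ordinal xp)) perm_nat_ord perm1.
Qed.

Lemma perm_natK s : cancel (perm_nat s) (perm_nat s^-1%g).
Proof. by move=> x; rewrite -perm_natM mulgV perm_nat1. Qed.

Lemma perm_natVK s : cancel (perm_nat s^-1%g) (perm_nat s).
Proof. by move=> x; rewrite -perm_natM mulVg perm_nat1. Qed.

Definition symN_perm (s : 'S_p) : symN := SymN (perm_natK s) (perm_natVK s).

End OrdinalPermutations.

Lemma perm_letters (T : eqType) (w w' : nat -> T) (p : nat) :
    perm_eq (letters w p) (letters w' p) ->
  exists s : 'S_p, forall i : 'I_p, w (s i) = w' i.
Proof.
rewrite perm_sym !lettersE.
pose t (v : nat -> T) : p.-tuple T := [tuple v (val i) | i < p].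
have tE v : t v = [seq v (val i) | i <- enum 'I_p] :> seq T.
  by [].
rewrite -!tE => /tuple_permP[s sE]; exists s => i.
have /(congr1 (fun u : p.-tuple T => tnth u i)) :
    t w' = [tuple tnth (t w) (s i) | i < p].
  exact: val_inj.
by rewrite !tnth_mktuple.
Qed.

Lemma perm_nat_letters (T : eqType) (w w' : nat -> T) (p : nat) (c0 : T) :
    (forall x, (p <= x)%N -> w x = w' x) ->
    (forall c, c != c0 ->
      count_mem c (letters w p) = count_mem c (letters w' p)) ->
  exists s : 'S_p, forall x, w (perm_nat s x) = w' x.
Proof.
move=> ww' cnt; have [|s sE] := @perm_letters _ w w' p.
  by apply: perm_eq_except1 cnt; rewrite !size_map.
exists s => x; have [xp|px] := ltnP x p; last by rewrite perm_nat_ge// ww'.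
by rewrite -[x]/(val (Ordinal xp)) perm_nat_ord.
Qed.

(** [g] injects the places of [w] with colour [c] into those of [w']. *)
Lemma count_letters_le (T : eqType) (w w' : nat -> T) (p q : nat) (c : T)
    (g : nat -> nat) : injective g ->
    (forall x, (x < p)%N -> w x = c -> (g x < q)%N /\ w' (g x) = c) ->
  (count_mem c (letters w p) <= count_mem c (letters w' q))%N.
Proof.
move=> ginj gP; rewrite !count_map -!size_filter -(size_map g).
apply: uniq_leq_size => [|_ /mapP[x + ->]].
  by rewrite map_inj_uniq// filter_uniq// iota_uniq.
rewrite !mem_filter !mem_iota !add0n /= => /andP[/eqP wx xp].
by have [gq ->] := gP x xp wx; rewrite gq eqxx.
Qed.

Lemma count_letters_sym (T : eqType) (w w' : nat -> T) (p q : nat) (c : T)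
    (g : symN) : (forall x, w' (g x) = w x) ->
    (forall x, (p <= x)%N -> w x <> c) -> (forall x, (q <= x)%N -> w' x <> c) ->
  count_mem c (letters w p) = count_mem c (letters w' q).
Proof.
move=> ww' wp wq; apply/eqP; rewrite eqn_leq; apply/andP; split.
  apply: (@count_letters_le _ _ _ _ _ _ g); first exact: can_inj (@sym_funK g).
  move=> x _ wx; rewrite ww'; split=> //.
  by rewrite ltnNge; apply/negP => /wq; rewrite ww'.
apply: (@count_letters_le _ _ _ _ _ _ (sym_inv g)).
  exact: can_inj (@sym_invK g).
move=> x _ wx; rewrite -ww' sym_invK; split=> //.
by rewrite ltnNge; apply/negP => /wp; rewrite -ww' sym_invK.
Qed.

(** * Cosets of Young subgroups as words *)

Lemma count_interval (a c p : nat) :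
  count (fun x => (a <= x < c)%N) (iota 0 p) = (minn c p - minn a p)%N.
Proof.
elim: p => [|p IH]; first by rewrite !minn0.
by rewrite -[in LHS]addn1 iotaD count_cat IH /= add0n; lia.
Qed.

HB.instance Definition _ (k : fieldType) (n : option nat) (t : k)
  (b : weight n t) := gen_eqMixin (coset_space b).
HB.instance Definition _ (k : fieldType) (n : option nat) (t : k)
  (b : weight n t) := gen_choiceMixin (coset_space b).

(** * Words that number consecutive intervals of given lengths *)

Section IntervalWords.
Variables (s : nat) (f : nat -> nat).

Local Notation psum i := (\sum_(s <= j < i) f j)%N.

Definition interval_letter (i x : nat) : Prop := (psum i <= x < psum i.+1)%N.

Lemma partial_sum_le (i j : nat) : (i <= j)%N -> (psum i <= psum j)%N.
Proof.
move=> ij; have [si|si] := leqP s i; last by rewrite big_geq// ltnW.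
by rewrite [leqRHS](big_cat_nat si ij)/= leq_addr.
Qed.

Lemma partial_sum_ge (M i : nat) : (forall j, (M <= j)%N -> f j = 0%N) ->
  (psum i <= psum M)%N.
Proof.
move=> f0; have [iM|Mi] := leqP i M; first exact: partial_sum_le.
have [sM|sM] := leqP s M.
  rewrite (big_cat_nat sM (ltnW Mi))/= [X in (_ + X)%N]big1_seq ?addn0//.
  by move=> j /andP[_]; rewrite mem_index_iota => /andP[Mj _]; exact: f0.
rewrite big1_seq// => j; rewrite mem_index_iota => /andP[_ /andP[sj _]].
by apply: f0; rewrite (leq_trans (ltnW sM)).
Qed.

Lemma interval_letter_uniq i j x :
  interval_letter i x -> interval_letter j x -> i = j.
Proof.
move=> /andP[ix xi] /andP[jx xj].
by case: (ltngtP i j) => // lt; have := partial_sum_le lt; lia.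
Qed.

Lemma interval_letter_range i x : interval_letter i x ->
  (s <= i)%N && (f i != 0%N).
Proof.
rewrite /interval_letter => /andP[].
have [si|si] := leqP s i; last by rewrite !big_geq//; lia.
by rewrite big_nat_recr//=; lia.
Qed.

(** The default 1 is the colour of the infinite block when [s] is 2, and of the padding after the
    last block when [s] is 1. *)
Definition interval_word (x : nat) : nat := xget 1%N [set i | interval_letter i x].

Lemma interval_wordE i x : interval_letter i x -> interval_word x = i.
Proof.
rewrite /interval_word; case: xgetP => [j _ /= jx|/(_ i)//].
exact: interval_letter_uniq.
Qed.

Lemma interval_wordP x :
  interval_letter (interval_word x) x \/
    interval_word x = 1%N /\ forall i, ~ interval_letter i x.
Proof. by rewrite /interval_word; case: xgetP => [j _ jx|nx]; [left|right]. Qed.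

Lemma interval_letter_exists M x : (x < psum M)%N -> exists i, interval_letter i x.
Proof.
elim: M => [|M IH] xM; first by rewrite big_geq in xM.
have [/IH//|Mx] := ltnP x (psum M).
by exists M; rewrite /interval_letter Mx.
Qed.

(** The last hypothesis keeps places that merely received the default letter from being counted. *)
Lemma count_interval_word p i : (s <= i)%N -> (psum i.+1 <= p)%N ->
    (forall x, (x < p)%N -> interval_word x = i -> interval_letter i x) ->
  count_mem i (letters interval_word p) = f i.
Proof.
move=> si; rewrite big_nat_recr//= => ip iP.
rewrite count_map (eq_in_count (a2 := fun x => psum i <= x < psum i.+1)%N).
  by rewrite count_interval big_nat_recr//=; lia.
move=> x; rewrite mem_iota add0n /= => xp.
by apply/eqP/idP => [/(iP x xp)//|]; exact: interval_wordE.
Qed.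

End IntervalWords.

Section CosetWords.
Variables (k : fieldType) (n : option nat) (t : k) (b : weight n t).
Hypothesis n1 : in_range n 1.

Lemma tail_out (i : nat) : ~~ ((2 <= i)%N && in_range n i) -> tail b i = 0%N.
Proof.
move=> ir; apply/eqP/negPn/negP; have /asboolP[_ h _ _] := valP b => /h.
exact/negP.
Qed.

Lemma tail_block_range i x : tail_block b i x -> (2 <= i)%N && in_range n i.
Proof.
move=> /(@interval_letter_range 2) /andP[_]; apply: contraNT => /tail_out ->.
by [].
Qed.

Definition base_word : nat -> nat := interval_word 2 (tail b).

Lemma base_word_tail i x : i != 1%N -> base_word x = i <-> tail_block b i x.
Proof.
move=> i1; split=> [xi|]; last exact: interval_wordE.
have [|[x1 _]] := interval_wordP 2 (tail b) x; first by rewrite -/base_word xi.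
by rewrite -xi /base_word x1 in i1.
Qed.

Lemma base_wordP x :
  tail_block b (base_word x) x \/
    base_word x = 1%N /\ forall i, ~ tail_block b i x.
Proof. exact: interval_wordP. Qed.

Lemma block_base_word i x : (0 < i)%N -> block b i x <-> base_word x = i.
Proof.
move=> i0; rewrite /block; case: eqVneq => [->|i1]; last first.
  exact: iff_sym (base_word_tail _ i1).
split=> [h|x1 [j _ /= jx]].
  case: (base_wordP x) => [bx|[]//]; exfalso; apply: h.
  by exists (base_word x) => //=; have /andP[] := tail_block_range bx.
by have /andP[] := tail_block_range jx; rewrite -(interval_wordE jx) -/base_word x1.
Qed.

Lemma base_word_range x : in_range n (base_word x).
Proof. by case: (base_wordP x) => [/tail_block_range/andP[]|[-> _]]. Qed.

(** The blocks with index in range are the level sets of [base_word], so preserving all of them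
    amounts to preserving the word. *)
Lemma youngE g : young b g <-> forall x, base_word (g x) = base_word x.
Proof.
split=> [gb x|gb i ni].
  have i0 : (0 < base_word x)%N by have /andP[] := base_word_range x.
  apply/(block_base_word _ i0); rewrite -[block _ _](gb _ (base_word_range x)).
  by exists x => //; exact/block_base_word.
have i0 : (0 < i)%N by have /andP[] := ni.
apply/seteqP; split=> [_ [x /(block_base_word _ i0) xi <-]|x].
  by apply/block_base_word => //; rewrite gb.
move=> /(block_base_word _ i0) xi; exists (sym_inv g x); last by rewrite sym_invK.
by apply/block_base_word => //; rewrite -gb sym_invK.
Qed.

Lemma base_word_bounded : exists N, forall p, (N <= p)%N ->
  (forall x, (p <= x)%N -> base_word x = 1%N) /\
  forall i, (2 <= i)%N -> count_mem i (letters base_word p) = tail b i.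
Proof.
have /asboolP[_ _ /finite_seqP[s bs] _] := valP b.
pose M := (\max_(i <- s) i).+1.
have tail0 j : (M <= j)%N -> tail b j = 0%N.
  move=> Mj; apply/eqP/negPn/negP => nz.
  have js : j \in s.
    by have : [set i | tail b i != 0%N] j by []; rewrite /tail bs.
  by move: Mj; rewrite ltnNge (@leq_bigmax_seq _ _ xpredT id).
have psumM i := partial_sum_ge 2 i tail0.
exists (\sum_(2 <= j < M) tail b j)%N => p Mp; split=> [x px|i i2].
  case: (base_wordP x) => [/andP[_ xi]|[]//].
  by have := psumM (base_word x).+1; lia.
apply: count_interval_word => //; first exact: leq_trans (psumM _) Mp.
by move=> x _ /base_word_tail; apply; lia.
Qed.

(** The colouring carried by a coset of representative g: place x gets the base colour of [g^-1 x].
    By [coset_wordE] every representative gives the same word. *)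
Definition coset_word (C : coset_set b) : nat -> nat :=
  base_word \o sym_inv (sval (cid (Defs.cosetP C))).

Lemma coset_wordE (C : coset_set b) g :
  coset_val C = left_coset b g -> coset_word C = base_word \o sym_inv g.
Proof.
rewrite /coset_word; case: cid => h /= -> hg.
have [s sb <-] : left_coset b h g.
  by rewrite hg; exists 1%g; [exact: young1|rewrite mulg1].
apply: funext => x /=; rewrite -[in LHS](sym_invK s (sym_inv h x)).
by have /youngE -> := sb.
Qed.

Lemma coset_wordP (C : coset_set b) :
  exists2 g, coset_val C = left_coset b g & coset_word C = base_word \o sym_inv g.
Proof. by have [g Cg] := Defs.cosetP C; exists g => //; exact: coset_wordE. Qed.

Lemma coset_word_act h (C : coset_set b) :
  coset_word (fin_act h C) = coset_word C \o sym_inv h.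
Proof.
have [g Cg ->] := coset_wordP C; rewrite (@coset_wordE _ (h * g)%g)//=.
rewrite Cg /left_coset image_comp; apply: eq_imagel => x _ /=.
by rewrite mulgA.
Qed.

Lemma left_coset_word (C : coset_set b) g :
  coset_word C = base_word \o sym_inv g -> coset_val C = left_coset b g.
Proof.
have [h Ch ->] := coset_wordP C => hg; rewrite Ch.
have hgx x : base_word (sym_inv h x) = base_word (sym_inv g x).
  by have := congr1 (@^~ x) hg.
apply/seteqP; split=> _ [s sb <-].
  exists (g^-1 * h * s)%g; last by rewrite !mulgA mulgV mul1g.
  by apply/youngE => x /=; rewrite -hgx sym_funK (proj1 (youngE s) sb).
exists (h^-1 * g * s)%g; last by rewrite !mulgA mulgV mul1g.
by apply/youngE => x /=; rewrite hgx sym_funK (proj1 (youngE s) sb).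
Qed.

Lemma coset_word_inj : injective coset_word.
Proof.
move=> C D CD; have [g Dg Dw] := coset_wordP D; apply: coset_eq.
by rewrite Dg; apply: left_coset_word; rewrite CD.
Qed.

(* The colour 0 is included: it does not occur, since tail b 0 = 0. *)
Definition coset_words (p : nat) : set (nat -> nat) :=
  [set w | (forall x, (p <= x)%N -> w x = 1%N)
    /\ forall i, i != 1%N -> count_mem i (letters w p) = tail b i].

Lemma coset_words_supp p w : coset_words p w ->
  forall x, (p <= x)%N -> w x = 1%N.
Proof. by case. Qed.

Lemma tail0 : tail b 0 = 0%N.
Proof. exact: tail_out. Qed.

Lemma coset_words_range p w x : coset_words p w -> in_range n (w x).
Proof.
move=> [supp cnt]; have [/supp->//|xp] := leqP p x.
have [->//|w1] := eqVneq (w x) 1%N.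
have := cnt _ w1; case: (boolP (in_range n (w x))) => // nr.
rewrite (@tail_out (w x)) ?(negPf nr) ?andbF//.
move=> /eqP; rewrite eqn0Ngt -has_count => /hasPn/(_ (w x)).
by rewrite /= eqxx; apply; apply/mapP; exists x; rewrite // mem_iota.
Qed.

Lemma coset_word_mem p C : (forall x, (p <= x)%N -> coset_word C x = 1%N) ->
  coset_words p (coset_word C).
Proof.
move=> Cp; split=> // i i1.
have [g Cg CE] := coset_wordP C; have [N NP] := base_word_bounded.
have [bN cntN] := NP N (leqnn N).
have [i2|i2] := leqP 2 i.
  rewrite -cntN//; apply: (@count_letters_sym _ _ _ _ _ _ (symN_inv g)).
  - by move=> x; rewrite CE.
  - by move=> x px; rewrite Cp//; lia.
  - by move=> x px; rewrite bN//; lia.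
have -> : i = 0%N by lia.
rewrite tail0; apply/eqP; rewrite eqn0Ngt -has_count; apply/hasPn.
move=> _ /mapP[x _ ->]; rewrite CE /= -lt0n.
by have /andP[] := base_word_range (sym_inv g x).
Qed.

(** A word trivial from p on is unchanged when only those places move. Conversely, if C is fixed,
    the transposition of a place x >= p with some y >= p of colour 1 stabilizes the first p places,
    so x has colour 1 too. *)
Lemma coset_word_fixed p C :
  (forall g, stab_upto p g -> fin_act g C = C) <-> coset_words p (coset_word C).
Proof.
split=> [fixC|[Cp _] g gp]; last first.
  apply: coset_word_inj; rewrite coset_word_act; apply: funext => x /=.
  have gVp y : (y < p)%N -> sym_inv g y = y.
    by move=> yp; rewrite -[in LHS](gp y yp) sym_funK.
  have [xp|px] := ltnP x p; first by rewrite gVp.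
  rewrite !Cp// leqNgt; apply/negP => xp; have := gVp _ xp.
  move=> /(can_inj (@sym_invK g)) xE.
  by move: xp; rewrite xE ltnNge px.
apply: coset_word_mem => x px.
have [g Cg CE] := coset_wordP C; have [N NP] := base_word_bounded.
have [bN _] := NP N (leqnn N).
(* Pigeonhole: otherwise [g^-1] would inject N + 1 places into the N places where [base_word] may be
   nontrivial. *)
have [y py Cy] : exists2 y, (p <= y)%N & coset_word C y = 1%N.
  apply: contrapT => h.
  have hN z : (z <= N)%N -> (sym_inv g (p + z) < N)%N.
    move=> _; rewrite ltnNge; apply/negP => /bN bz; apply: h.
    by exists (p + z)%N; rewrite ?leq_addr// CE.
  suff : (size [seq sym_inv g (p + z) | z <- iota 0 N.+1] <= size (iota 0 N))%N.
    by rewrite size_map !size_iota ltnn.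
  apply: uniq_leq_size => [|_ /mapP[z + ->]].
    rewrite map_inj_uniq ?iota_uniq// => u v /(can_inj (@sym_invK g))/eqP.
    by rewrite eqn_add2l => /eqP.
  by rewrite !mem_iota !add0n /=; exact: hN.
have xy : stab_upto p (symN_transp x y).
  move=> z /= zp; rewrite /transp; case: eqP => [zx|_]; first by lia.
  by case: eqP => // zy; lia.
have /(congr1 (fun D => coset_word D y)) := fixC _ xy.
rewrite coset_word_act /= Cy => <-; rewrite /transp eqxx.
by case: eqP => // ->.
Qed.

Definition word_coset (w : nat -> nat) : coset_set b :=
  xget (CosetSpace (ex_intro _ 1%g (erefl (left_coset b 1%g))))
    [set C | coset_word C = w].

Lemma coset_wordK : cancel coset_word word_coset.
Proof.
move=> C; rewrite /word_coset; case: xgetP => [D _ /coset_word_inj//|/(_ C)].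
by case.
Qed.

(** From q on, [w] and [base_word] are both 1, and below q they have the same multiplicities. So a
    permutation of the first q places turns one into the other, and it represents the coset
    sought. *)
Lemma word_cosetK p w : coset_words p w -> coset_word (word_coset w) = w.
Proof.
move=> [wp cntw].
suff [C Cw] : exists C, coset_word C = w by rewrite -Cw coset_wordK.
have [N NP] := base_word_bounded.
pose q := maxn p N; have [bq cntq] := NP q (leq_maxr _ _).
have wq x : (q <= x)%N -> w x = 1%N by rewrite geq_max => /andP[/wp].
have [||s sE] := @perm_nat_letters _ w base_word q 1%N.
- by move=> x qx; rewrite wq// bq.
- move=> i i1; have -> : count_mem i (letters w q) = count_mem i (letters w p).
    apply: (@count_letters_sym _ _ _ _ _ _ 1%g) => // x; first by move/wq->; lia.
    by move/wp->; lia.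
  rewrite cntw//; have [i2|i2] := leqP 2 i; first by rewrite cntq.
  have -> : i = 0%N by lia.
  rewrite tail0; apply/esym/eqP; rewrite eqn0Ngt -has_count; apply/hasPn.
  by move=> _ /mapP[x _ ->] /=; rewrite -lt0n; have /andP[] := base_word_range x.
exists (CosetSpace
  (ex_intro _ (symN_perm s) (erefl (left_coset b (symN_perm s))))).
rewrite (@coset_wordE _ (symN_perm s))//; apply: funext => x /=.
by rewrite -sE perm_natVK.
Qed.

Lemma word_coset_act p q h w :
    coset_words p w -> coset_words q (w \o sym_inv h) ->
  word_coset (w \o sym_inv h) = fin_act h (word_coset w).
Proof.
move=> pw qw; apply: coset_word_inj; rewrite coset_word_act.
by rewrite (word_cosetK qw) (word_cosetK pw).
Qed.

End CosetWords.

(** * Counting words by their nontrivial places *)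

(** Each fibre sum is written with an indicator and the two sums are exchanged. *)
Lemma fsbig_partition (R : Type) (idx : R) (op : Monoid.com_law idx)
    (I J : choiceType) (A : set I) (B : set J) (h : I -> J) (F : I -> R) :
    finite_set A -> finite_set B -> (forall x, A x -> B (h x)) ->
  \big[op/idx]_(x \in A) F x =
  \big[op/idx]_(j \in B) \big[op/idx]_(x \in A `&` h @^-1` [set j]) F x.
Proof.
move=> fA fB hAB; under [RHS]eq_fsbigr do rewrite fsbig_mkcondr.
rewrite exchange_fsbig//; apply: eq_fsbigr => x /set_mem Ax.
rewrite -(fsbig_widen [set h x] B) => [|_ -> //|j [_ jx]]; last 2 first.
- exact: hAB.
- by rewrite /= memNset// => /esym.
by rewrite fsbig_set1 mem_set.
Qed.

Lemma fsbig_finType (R : Type) (idx : R) (op : Monoid.com_law idx)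
    (I : finType) (P : pred I) (F : I -> R) :
  \big[op/idx]_(i \in [set` P]) F i = \big[op/idx]_(i | P i) F i.
Proof.
rewrite -(@bigfs _ _ _ _ (index_enum I)) ?index_enum_uniq// => i _.
by rewrite mem_index_enum.
Qed.

(** Composing with this permutation brings the nontrivial places of a word beyond q to the front of
    that range. Since it fixes the first q places, functions invariant under [stab_upto q] do not
    notice. *)
Lemma gather (q p : nat) (P : pred nat) : (q <= p)%N ->
    (forall x, P x -> (q <= x < p)%N) ->
  exists g : 'S_p, (forall x, (x < q)%N -> perm_nat g x = x) /\
    forall x, P (perm_nat g x) = (q <= x < q + count P (iota 0 p))%N.
Proof.
move=> qp Pq; set s := count P _.
have sp : (q + s <= p)%N.
  have : (s <= count (fun x => q <= x < p)%N (iota 0 p))%N.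
    by apply: sub_count => x /Pq.
  by rewrite count_interval; lia.
(* Places below q carry the pairwise distinct letters x + 2, which force the permutation to fix
   them; the letters 1 and 0 record membership in [P]. *)
pose w x := if (x < q)%N then x.+2 else P x : nat.
pose w' x := if (x < q)%N then x.+2 else (q <= x < q + s)%N : nat.
have [||g gE] := @perm_nat_letters _ w w' p 0%N.
- move=> x px; rewrite /w /w' ltnNge (leq_trans qp px) /=.
  have -> : (x < q + s)%N = false by lia.
  by case: (boolP (P x)) => // /Pq; lia.
- case=> [//|[_|c _]]; rewrite !count_map.
    rewrite (eq_count (a2 := P)); last first.
      move=> x /=; rewrite /w; case: ifPn => xq; last by case: (P x).
      by apply/esym/negP => /Pq; lia.
    rewrite -/s (eq_count (a2 := fun x => q <= x < q + s)%N).
      by rewrite count_interval; lia.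
    by move=> x /=; rewrite /w'; case: ifPn => xq; [apply/esym; lia|case: (_ && _)].
  apply: eq_count => x /=; rewrite /w /w'; case: ifP => // _.
  by case: (P x); case: (_ && _).
exists g; split=> x.
  move=> xq; have := gE x; rewrite /w /w' xq.
  by case: ifPn => [_ [->//]|_]; case: (P _).
have := gE x; rewrite /w /w'; case: ifPn => [gq|gq].
  case: ifPn => [xq _|xq]; last by case: (_ && _).
  have -> : (q <= x)%N = false by lia.
  by apply/negP => /Pq; lia.
case: ifPn => xq; first by case: (P _).
by case: (P _); case: (_ && _).
Qed.

Section Strata.
Variables (k : fieldType) (n : option nat) (t : k) (b : weight n t).
Hypothesis n1 : in_range n 1.

(** Every such word is [base_word] composed with one of the finitely many permutations of the first
    r places. *)
Lemma coset_words_finite (p : nat) : finite_set (coset_words b p).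
Proof.
have [N NP] := base_word_bounded b n1; pose r := maxn p N.
apply: (@sub_finite_set _ _
  [set base_word b \o perm_nat s | s in [set: 'S_r]]); last first.
  exact/finite_image/finite_finset.
move=> w wp.
have [C Cw] : exists C : coset_set b, coset_word C = w.
  by exists (word_coset b w); exact: (word_cosetK n1 wp).
have wr : coset_words b r w.
  rewrite -Cw; apply: coset_word_mem => // x rx.
  by rewrite Cw (coset_words_supp wp); lia.
have [br cntr] := NP r (leq_maxr _ _).
have [x rx|i i1|s sE] := @perm_nat_letters _ (base_word b) w r 1%N.
- by rewrite br// (coset_words_supp wr).
- have [_ ->//] := wr; have [i2|i2] := leqP 2 i; first by rewrite cntr.
  have -> : i = 0%N by lia.
  rewrite tail0; apply/eqP; rewrite eqn0Ngt -has_count; apply/hasPn.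
  by move=> _ /mapP[x _ ->] /=; rewrite -lt0n; have /andP[] := base_word_range b n1 x.
by exists s => //; apply: funext => x /=.
Qed.

Lemma coset_words_sym p r (g : symN) w : coset_words b p w ->
  (forall x, (r <= x)%N -> w (g x) = 1%N) -> coset_words b r (w \o g).
Proof.
move=> wp gr; have -> : w \o g = coset_word (fin_act g^-1%g (word_coset b w)).
  by rewrite coset_word_act// (word_cosetK n1 wp).
apply: coset_word_mem => // x rx.
by rewrite coset_word_act// (word_cosetK n1 wp); exact: gr.
Qed.

Lemma coset_words_le p r w : (p <= r)%N -> coset_words b p w -> coset_words b r w.
Proof.
move=> pr wp; apply: (@coset_words_sym p r 1%g w wp) => x rx /=.
by rewrite (coset_words_supp wp)//; lia.
Qed.

Lemma word_coset_sym p r (g : symN) w : coset_words b p w ->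
  (forall x, (r <= x)%N -> w (g x) = 1%N) ->
  word_coset b (w \o g) = fin_act g^-1%g (word_coset b w).
Proof.
move=> wp gr; apply: (@word_coset_act _ _ _ b n1 p r g^-1%g w wp).
exact: (@coset_words_sym p r g w wp gr).
Qed.

(** The inverse of a representative sends nontrivial places of the word injectively to nontrivial
    places of [base_word], all of them below N. *)
Lemma coset_words_length : exists N, forall p q s w, coset_words b p w ->
  (forall x, (q <= x < q + s)%N -> w x <> 1%N) -> (s <= N)%N.
Proof.
have [N NP] := base_word_bounded b n1; have [bN _] := NP N (leqnn N).
exists N => p q s w wp ws.
have [g _ wE] := coset_wordP n1 (word_coset b w).
rewrite (word_cosetK n1 wp) in wE.
suff : (size [seq sym_inv g (q + z) | z <- iota 0 s] <= size (iota 0 N))%N.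
  by rewrite size_map !size_iota.
apply: uniq_leq_size => [|_ /mapP[z + ->]].
  rewrite map_inj_uniq ?iota_uniq// => u v /(can_inj (@sym_invK g))/eqP.
  by rewrite eqn_add2l => /eqP.
rewrite !mem_iota !add0n /= => zs; rewrite ltnNge; apply/negP => /bN bz.
by apply: (ws (q + z)%N); [lia|rewrite wE].
Qed.

Variable q : nat.

(** Normal forms of the words with exactly s nontrivial places beyond q. *)
Definition stratum (s : nat) : set (nat -> nat) :=
  coset_words b (q + s) `&`
    [set w | forall x, (q <= x < q + s)%N -> w x <> 1%N].

Lemma stratum_gather (p : nat) (P : pred nat) : (q <= p)%N ->
    (forall x, P x -> (q <= x < p)%N) ->
  exists2 g : 'S_p, forall x, (x < q)%N -> perm_nat g x = x &
    set_bij (coset_words b p `&`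
       [set w | forall x, (q <= x)%N -> (w x != 1%N) = P x])
      (stratum (count P (iota 0 p))) (fun w => w \o perm_nat g).
Proof.
move=> qp Pq; have [g [gq gP]] := gather qp Pq; exists g => //.
set s := count P _ in gP *.
have gge x : (q <= perm_nat g x)%N = (q <= x)%N.
  have [qx|xq] := leqP q x; last by rewrite gq// leqNgt xq.
  rewrite leqNgt; apply/negP => gx; have := gq _ gx.
  by move=> /(can_inj (perm_natK g)) gxx; rewrite gxx ltnNge qx in gx.
split.
- move=> w [wp wP]; split.
    apply: (@coset_words_sym p (q + s) (symN_perm g) w wp) => x qsx.
    have qx : (q <= x)%N by lia.
    apply/eqP/negPn; rewrite -[_ (symN_perm _) _]/(perm_nat g x).
    by rewrite /= wP ?gge// gP; lia.
  by move=> x xs; apply/eqP; rewrite /= wP ?gge ?gP//; lia.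
- move=> w w' _ _ ww'; apply: funext => x; rewrite -(perm_natVK g x).
  exact: (congr1 (@^~ (perm_nat g^-1%g x)) ww').
move=> w [ws wne]; have wsupp := coset_words_supp ws.
have gVge x : (q <= perm_nat g^-1%g x)%N = (q <= x)%N.
  by rewrite -gge perm_natVK.
exists (w \o perm_nat g^-1%g); last by apply: funext => x /=; rewrite perm_natK.
have wP x : (q <= x)%N -> (w (perm_nat g^-1%g x) != 1%N) = P x.
  move=> qx; rewrite -[in RHS](perm_natVK g x) gP.
  apply/idP/idP => [w1|/wne/eqP//].
  by rewrite gVge qx /= ltnNge; apply/negP => /wsupp w1'; rewrite w1' eqxx in w1.
split=> //; apply: (@coset_words_sym (q + s) p (symN_perm g^-1%g) w ws) => x px.
apply/eqP/negPn; rewrite [_ (symN_perm _) _]/(perm_nat g^-1%g x).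
by rewrite wP ?(leq_trans qp px)//; apply/negP => /Pq; lia.
Qed.

Lemma stratum_empty : exists N, forall s, (N < s)%N -> stratum s = set0.
Proof.
have [N NP] := coset_words_length; exists N => s Ns.
by apply/seteqP; split=> // w [/NP wN /wN]; rewrite leqNgt Ns.
Qed.

(** Words are grouped by the set S of their nontrivial places between q and p. By [stratum_gather]
    each group has the same sum as the stratum of index #|S|, and C(p - q, s) sets have size s. *)
Lemma sum_coset_words (V : zmodType) (F : (nat -> nat) -> V) (N : nat) :
    (forall s, (N < s)%N -> stratum s = set0) ->
    (forall p w (g : 'S_p), coset_words b p w ->
      (forall x, (x < q)%N -> perm_nat g x = x) -> F (w \o perm_nat g) = F w) ->
  forall p, (q <= p)%N -> \sum_(w \in coset_words b p) F w =
    \sum_(s < N.+1) (\sum_(w \in stratum s) F w) *+ 'C(p - q, s).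
Proof.
move=> N0 Fg p qp; pose A := [set x : 'I_p | (q <= x)%N]%SET.
have cA : #|A| = (p - q)%N.
  rewrite cardE /enum_mem size_filter -enumT.
  rewrite (eq_count (a2 := preim val (fun x => q <= x < p)%N)) => [|i].
    by rewrite -count_map val_enum_ord count_interval; lia.
  by rewrite /= inE ltn_ord andbT.
pose supp (w : nat -> nat) := [set x : 'I_p | (q <= x)%N && (w x != 1%N)]%SET.
rewrite (@fsbig_partition _ _ _ _ _ _
  [set` (fun S : {set 'I_p} => S \subset A)] supp).
- rewrite fsbig_finType.
  under eq_bigr => S SA.
    pose P x := [exists i in S, val i == x].
    have Pq x : P x -> (q <= x < p)%N.
      move=> /existsP[i /andP[iS /eqP<-]]; rewrite ltn_ord andbT.
      by have := fintype.subsetP SA i iS; rewrite inE.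
    have PE (i : 'I_p) : P i = (i \in S).
      apply/existsP/idP => [[j /andP[jS /eqP/val_inj<-]]|iS] //.
      by exists i; rewrite iS eqxx.
    have cP : count P (iota 0 p) = #|S|.
      rewrite -val_enum_ord count_map -sum1_count -sum1_card big_enum_cond.
      by apply: eq_bigl => i; rewrite /= PE.
    have [g gq gbij] := stratum_gather qp Pq; rewrite cP in gbij.
    have -> : coset_words b p `&` supp @^-1` [set S] =
        coset_words b p `&` [set w | forall x, (q <= x)%N -> (w x != 1%N) = P x].
      apply/seteqP; split=> w [wp wS]; split=> //=.
        move=> x qx; have [xp|px] := ltnP x p.
          by rewrite -[x]/(val (Ordinal xp)) PE -wS inE qx.
        rewrite (coset_words_supp wp)// eqxx; apply/esym/negbTE/negP => /Pq; lia.
      apply/setP => i; rewrite inE -PE; case: (leqP q i) => qi; first by rewrite wS.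
      by apply/esym/negbTE/negP => /Pq; lia.
    rewrite (_ : \sum_(w \in _) F w = \sum_(w \in stratum #|S|) F w).
      over.
    rewrite (reindex_fsbig _ _ _ _ gbij); apply: eq_fsbigr => w /set_mem[wp _].
    by rewrite (Fg p).
  (* A common bound for the sizes of the sets S and for the indices of the nonempty strata. *)
  pose M := maxn N p.
  have cM (S : {set 'I_p}) : (#|S| < M.+1)%N.
    by rewrite ltnS (leq_trans (max_card _))// card_ord leq_maxr.
  rewrite (partition_big (fun S : {set 'I_p} => Ordinal (cM S)) xpredT)//=.
  rewrite (big_ord_widen M.+1
    (fun s => (\sum_(w \in stratum s) F w) *+ 'C(p - q, s))).
    rewrite [RHS]big_mkcond/=; apply: eq_bigr => s _.
    transitivity (\sum_(S : {set 'I_p} | (S \subset A) && (#|S| == s))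
                    \sum_(w \in stratum s) F w).
      by apply: eq_big => [S|S /andP[_ /eqP<-]].
    rewrite sumr_const -cA -cards_draws cardsE.
    case: ifPn => // sN; rewrite N0 ?fsbig_set0 ?mul0rn//; lia.
  by rewrite ltnS leq_maxl.
- exact: coset_words_finite.
- exact: finite_finset.
- by move=> w wp /=; apply/fintype.subsetP => x; rewrite !inE => /andP[].
Qed.

End Strata.

(** * Counting polynomials and integrals *)

Section CharacteristicZero.
Variable k : fieldType.
Hypothesis char0 : [pchar k] =i pred0.

Lemma char0_natr_eq0 (m : nat) : (m%:R == 0 :> k) = (m == 0%N).
Proof. exact: (proj1 (pcharf0P k) char0). Qed.

Lemma char0_natr_inj : injective (fun m : nat => m%:R : k).
Proof.
move=> m m' /eqP; wlog: m m' / (m <= m')%N => [hw e|mm' e].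
  by case/orP: (leq_total m m') => h; [apply: hw|apply/esym/hw; rewrite // eq_sym].
move: e; rewrite eq_sym -subr_eq0 -natrB// char0_natr_eq0 subn_eq0 => m'm.
by apply/eqP; rewrite eqn_leq mm'.
Qed.

Lemma char0_intr_eq0 (m : int) : (m%:~R == 0 :> k) = (m == 0).
Proof.
case: m => m; first exact: char0_natr_eq0.
by rewrite NegzE mulrNz oppr_eq0 char0_natr_eq0.
Qed.

(** [ratr] is defined by the reduced fraction. Sums and products naturally come as unreduced ones,
    which this handles. *)
Lemma ratr_char0E (x : rat) (a c : int) : c != 0 -> x * c%:~R = a%:~R ->
  ratr x = a%:~R / c%:~R :> k.
Proof.
move=> c0 xc; have h : numq x * c = a * denq x.
  apply: (@intr_inj rat); rewrite !rmorphM /= -xc numqE.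
  by rewrite mulrAC.
have dx : (denq x)%:~R != 0 :> k by rewrite char0_intr_eq0 denq_eq0.
have c0' : c%:~R != 0 :> k by rewrite char0_intr_eq0.
by apply/eqP; rewrite /ratr eqr_div// -!rmorphM /= h.
Qed.

Lemma ratr_char0_rmorphism : exists f : {rmorphism rat -> k}, f =1 ratr.
Proof.
have d0 x : denq x != 0 by rewrite denq_eq0.
have dk x : (denq x)%:~R != 0 :> k by rewrite char0_intr_eq0.
have add : zmod_morphism (@ratr k).
  move=> x y.
  rewrite (@ratr_char0E _ (numq x * denq y - numq y * denq x) (denq x * denq y)).
  - by rewrite /ratr !(rmorphM, rmorphB) /=; field; rewrite !dk.
  - by rewrite mulf_neq0.
  by rewrite !(rmorphM, rmorphB) /= !numqE; ring.
have mul : monoid_morphism (@ratr k).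
  split=> [|x y]; first by rewrite /ratr divr1.
  rewrite (@ratr_char0E _ (numq x * numq y) (denq x * denq y)).
  - by rewrite /ratr !rmorphM /=; field; rewrite !dk.
  - by rewrite mulf_neq0.
  by rewrite !rmorphM /= !numqE; ring.
by exists (HB.pack_for {rmorphism rat -> k} (@ratr k)
  (GRing.isZmodMorphism.Build rat k (@ratr k) add)
  (GRing.isMonoidMorphism.Build rat k (@ratr k) mul)).
Qed.

Lemma horner_map_ratr (P : {poly rat}) (m : nat) :
  (map_poly ratr P).[m%:R] = ratr P.[m%:R] :> k.
Proof.
have [f fE] := ratr_char0_rmorphism; rewrite -fE -(eq_map_poly fE).
by rewrite -(rmorph_nat f) horner_map.
Qed.

(** The difference vanishes at as many integers as its size, and their images in [k] are distinct in
    characteristic 0. *)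
Lemma poly_eq_eventually (q : nat) (P Q : {poly k}) :
  (forall p, (q <= p)%N -> P.[p%:R] = Q.[p%:R]) -> P = Q.
Proof.
move=> PQ; apply/eqP; rewrite -subr_eq0; apply/eqP.
apply: (@roots_geq_poly_eq0 _ _ [seq (q + i)%:R | i <- iota 0 (size (P - Q))]).
- apply/allP => _ /mapP[i _ ->].
  by rewrite /root hornerD hornerN PQ ?leq_addr// subrr.
- rewrite map_inj_uniq ?iota_uniq// => i j /char0_natr_inj/eqP.
  by rewrite eqn_add2l => /eqP.
- by rewrite size_map size_iota.
Qed.

(** The polynomial C(X - q, s). *)
Definition binomial_poly (q s : nat) : {poly k} :=
  (s`!)%:R^-1 *: \prod_(i < s) ('X - (q + i)%:R%:P).

Lemma binomial_polyE (q s p : nat) : (q <= p)%N ->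
  (binomial_poly q s).[p%:R] = ('C(p - q, s))%:R.
Proof.
move=> qp; have f0 : (s`!)%:R != 0 :> k by rewrite char0_natr_eq0 -lt0n fact_gt0.
rewrite /binomial_poly hornerZ horner_prod; apply: (mulfI f0).
rewrite mulVKf// -natrM mulnC bin_ffact.
have [sp|ps] := leqP s (p - q).
  rewrite ffact_prod natr_prod; apply: eq_bigr => i _.
  rewrite hornerXsubC -natrB; last by have := ltn_ord i; lia.
  by congr (_%:R); lia.
(* For s > p - q the factor of index p - q vanishes. *)
rewrite ffact_small// (bigD1 (Ordinal ps))//= hornerXsubC subnKC// subrr mul0r.
by [].
Qed.

End CharacteristicZero.

(** * Integrals over coset spaces as values of polynomials *)

Section Integrals.
Variables (k : fieldType) (n : option nat) (t : k) (b : weight n t).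
Hypothesis char0 : [pchar k] =i pred0.
Hypothesis n1 : in_range n 1.
Variable q : nat.

Definition stable (T : Type) (f : coset_set b -> T) : Prop :=
  forall g C, stab_upto q g -> f (fin_act g C) = f C.

Lemma stable_word T (f : coset_set b -> T) p r w (g : symN) : stable f ->
    coset_words b p w -> (forall x, (x < q)%N -> g x = x) ->
    (forall x, (r <= x)%N -> w (g x) = 1%N) ->
  f (word_coset b (w \o g)) = f (word_coset b w).
Proof.
move=> fq wp gq gr; rewrite (word_coset_sym n1 wp gr) fq//.
by move=> x xq /=; rewrite -[in LHS](gq x xq) sym_funK.
Qed.

(** The binomial coefficients of [sum_coset_words] become polynomials in p. Taking [F] to be the
    rationals yields the counting polynomials. *)
Lemma sum_coset_words_poly (F : fieldType) (f : coset_set b -> F) :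
    [pchar F] =i pred0 -> stable f ->
  exists P : {poly F}, forall p, (q <= p)%N ->
    P.[p%:R] = \sum_(w \in coset_words b p) f (word_coset b w).
Proof.
move=> charF fq; have [N N0] := stratum_empty b n1 q.
exists (\sum_(s < N.+1)
  (\sum_(w \in stratum b q s) f (word_coset b w)) *: binomial_poly F q s).
move=> p qp; rewrite (sum_coset_words n1 N0)//.
  rewrite horner_sum; apply: eq_bigr => s _.
  by rewrite hornerZ binomial_polyE// mulr_natr.
move=> r w g wr gq; apply: (@stable_word _ _ r r w (symN_perm g)) => // x rx.
by rewrite /= perm_nat_ge// (coset_words_supp wr).
Qed.

(** One and the same m serves every field, which carries the count from the rationals to [k]. *)
Lemma fixed_points_card (Z : set (coset_set b)) p :
  exists2 m, fixed_points Z p #= `I_m &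
    forall F : fieldType,
      \sum_(w \in coset_words b p) ((`[< Z (word_coset b w) >])%:R : F) = m%:R.
Proof.
pose D := coset_words b p `&` [set w | Z (word_coset b w)].
have fD : finite_set D.
  by apply: sub_finite_set (coset_words_finite b n1 p) => w [].
have [m Dm] := fD; exists m.
  suff -> : fixed_points Z p = word_coset b @` D.
    apply: card_eq_trans Dm; apply: inj_card_eq.
    move=> v w /set_mem[vp _] /set_mem[wp _] vw.
    by rewrite -(word_cosetK n1 vp) vw (word_cosetK n1 wp).
  apply/seteqP; split=> [C [ZC /(coset_word_fixed n1) Cp]|_ [w [wp Zw] <-]].
    by exists (coset_word C); [split=> //=; rewrite coset_wordK|rewrite coset_wordK].
  split=> //=; apply/(coset_word_fixed n1).
  by rewrite (word_cosetK n1 wp).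
move=> F; rewrite -[in RHS](card_fset_set Dm).
have -> : \sum_(w \in coset_words b p) ((`[< Z (word_coset b w) >])%:R : F) =
    \sum_(w \in D) (1 : F).
  rewrite [RHS]fsbig_mkcondr; apply: eq_fsbigr => w _.
  case: asboolP => Zw; first by rewrite mem_set.
  by rewrite memNset.
by rewrite fsbig_finite// big_const_seq count_predT iter_addr_0.
Qed.

(** The sum of the indicator of [Z] is polynomial from p = q on, whereas a counting polynomial is
    only required to count for large p. Uniqueness of the counting polynomial identifies the two. *)
Lemma mu_poly (Z : set (coset_set b)) : stable Z ->
  exists P : {poly k}, (forall t', mu t' Z = P.[t']) /\
    forall p, (q <= p)%N ->
      P.[p%:R] = \sum_(w \in coset_words b p) ((`[< Z (word_coset b w) >])%:R : k).
Proof.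
move=> Zq; pose f C : rat := (`[< Z C >])%:R.
have fq : stable f by move=> g C gq; rewrite /f Zq.
have charQ : [pchar rat] =i pred0 by exact: Num.Theory.pchar_num.
have [P PE] := sum_coset_words_poly charQ fq.
have cP : counting_polynomial Z P.
  exists q => p qp; have [m Zm mE] := fixed_points_card Z p.
  by exists m => //; rewrite PE// mE.
exists (map_poly ratr P); split=> [t'|p qp].
  rewrite /mu; case: xgetP => [Q QE cQ|/(_ P)//]; congr (map_poly _ _).[_].
  have [p0 p0Q] := cQ; have [p1 p1P] := cP.
  apply: (poly_eq_eventually charQ (q := maxn p0 p1)) => p.
  rewrite geq_max => /andP[/p0Q[m Zm ->] /p1P[m' Zm' ->]].
  by rewrite -(card_fset_set Zm) -(card_fset_set Zm').
rewrite horner_map_ratr// PE//.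
have [m _ mE] := fixed_points_card Z p.
by rewrite mE (mE rat) ratr_nat.
Qed.

(** Gathering nontrivial places by a permutation that fixes the first q places leaves the value of
    [f] unchanged and produces one of the finitely many words trivial from q + N on. *)
Lemma stable_finite_range T (f : coset_set b -> T) : stable f ->
  finite_set (range f).
Proof.
move=> fq; have [N NP] := coset_words_length b n1.
apply: (@sub_finite_set _ _
  ((f \o word_coset b) @` coset_words b (q + N))); last first.
  exact/finite_image/coset_words_finite.
move=> _ [C _ <-]; have [r rC] := fin_stab_upto C.
pose p := maxn q r; have wp : coset_words b p (coset_word C).
  by apply/coset_word_fixed => // g gp; apply: rC gp; exact: leq_maxr.
set w := coset_word C in wp.
pose P x := (q <= x)%N && (w x != 1%N).
have Pq x : P x -> (q <= x < p)%N.
  move=> /andP[-> w1] /=; rewrite ltnNge; apply/negP => /(coset_words_supp wp) w1'.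
  by rewrite w1' eqxx in w1.
have [g gq gbij] := stratum_gather b n1 (leq_maxl q r) Pq.
set s := count _ _ in gbij.
have [ws wne] : stratum b q s (w \o perm_nat g).
  by case: gbij => h _ _; apply: h; split=> // x qx; rewrite /P qx.
have sN : (s <= N)%N by apply: NP ws wne.
have wN : coset_words b (q + N) (w \o perm_nat g).
  by apply: coset_words_le ws; rewrite // leq_add2l.
exists (w \o perm_nat g) => //=.
rewrite -[RHS]/(f C) -(coset_wordK n1 C).
apply: (@stable_word _ f p (q + N) w (symN_perm g)) => // x.
exact: (coset_words_supp wN).
Qed.

(** The polynomial is the sum of c P_c over the values c, where P_c comes from [mu_poly] for the
    level set of c. At p, each word contributes only through the level set of its own value. *)
Lemma integral_poly (t' : k) (f : coset_set b -> k) : stable f ->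
  exists P : {poly k}, integral t' f = P.[t'] /\
    forall p, (q <= p)%N ->
      P.[p%:R] = \sum_(w \in coset_words b p) f (word_coset b w).
Proof.
move=> fq; have fR := stable_finite_range fq.
have level c : stable (f @^-1` [set c]) by move=> g C gq; rewrite /preimage /= fq.
have [P PE] := choice (fun c => mu_poly (level c)).
exists (\sum_(c \in range f) c *: P c); split=> [|p qp].
  rewrite /integral !fsbig_finite//= horner_sum; apply: eq_bigr => c _.
  by rewrite hornerZ (proj1 (PE c)).
rewrite fsbig_finite//= horner_sum -fsbig_finite//=.
have fW := coset_words_finite b n1 p.
under eq_fsbigr do rewrite hornerZ (proj2 (PE _) _ qp) mulr_fsumr.
rewrite exchange_fsbig//; apply: eq_fsbigr => w _.
have fw : range f (f (word_coset b w)) by exists (word_coset b w).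
rewrite -(fsbig_widen [set f (word_coset b w)]) => [|_ -> //|c [_ /= nc]].
  rewrite fsbig_set1 (_ : `[< _ >] = true) ?mulr1//.
  exact/asboolP.
rewrite (_ : `[< _ >] = false) ?mulr0//.
by apply/asboolP => h; apply: nc.
Qed.

(** This is where the parameter being the integer d enters: the polynomial is evaluated at a point
    where it still equals the sum over words. *)
Lemma integral_sum (d : nat) (f : coset_set b -> k) : stable f -> (q <= d)%N ->
  integral d%:R f = \sum_(w \in coset_words b d) f (word_coset b w).
Proof. by move=> fq qd; have [P [-> PE]] := integral_poly d%:R fq; rewrite PE. Qed.

(** Level sets of a combination are not easily related to those of [f] and [g]. The polynomials are
    compared instead: their values at p >= q are sums over words, hence linear. *)
Lemma integral_linear (t' a : k) (f g : coset_set b -> k) :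
    stable f -> stable g ->
  integral t' (fun C => a * f C + g C) = a * integral t' f + integral t' g.
Proof.
move=> fq gq; have [P [-> PE]] := integral_poly t' fq.
have [Q [-> QE]] := integral_poly t' gq.
have [|S [-> SE]] := @integral_poly t' (fun C => a * f C + g C).
  by move=> h C hq; rewrite fq// gq.
suff -> : S = a *: P + Q by rewrite hornerD hornerZ.
apply: (poly_eq_eventually char0 (q := q)) => p qp.
have fW := coset_words_finite b n1 p.
rewrite hornerD hornerZ PE// QE// SE// !fsbig_finite//= mulr_sumr -big_split.
by [].
Qed.

End Integrals.

(** * Restriction to words of length d *)

Section Bilinearity.
Variables (k : fieldType) (n : option nat) (t : k).
Hypothesis char0 : [pchar k] =i pred0.
Hypothesis n1 : in_range n 1.
Implicit Types a b c : weight n t.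

Lemma perm_hom_act (X Y : finitary_set) (f : perm_hom k X Y) g y x :
  f (fin_act g y, fin_act g x) = f (y, x).
Proof. by have /asboolP := perm_homP f; exact. Qed.

Lemma stable_product a b c q (g : perm_hom k (coset_set b) (coset_set c))
    (f : perm_hom k (coset_set a) (coset_set b)) z x :
    (forall h, stab_upto q h -> fin_act h z = z) ->
    (forall h, stab_upto q h -> fin_act h x = x) ->
  stable q (fun y => g (z, y) * f (y, x) : k).
Proof.
move=> qz qx h y hq.
by rewrite -{1}(qz h hq) -{1}(qx h hq) !perm_hom_act.
Qed.

Lemma fin_stab_upto2 (X Y : finitary_set) (x : X) (y : Y) : exists q,
  (forall h, stab_upto q h -> fin_act h x = x) /\
  (forall h, stab_upto q h -> fin_act h y = y).
Proof.
have [q qx] := fin_stab_upto x; have [r ry] := fin_stab_upto y.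
by exists (maxn q r); split=> h; [apply: qx|apply: ry]; rewrite (leq_maxl, leq_maxr).
Qed.

Lemma perm_compl a b c (s : k) (g g' : perm_hom k (coset_set b) (coset_set c))
    (f : perm_hom k (coset_set a) (coset_set b)) :
  perm_comp t (s *: g + g') f = s *: perm_comp t g f + perm_comp t g' f.
Proof.
apply/val_inj/funext => -[z x].
have [q [qz qx]] := fin_stab_upto2 z x.
rewrite /= -[RHS]/(s * perm_comp_val t g f (z, x) + perm_comp_val t g' f (z, x)).
rewrite /perm_comp_val /= -(integral_linear char0 n1 t s
  (stable_product g f qz qx) (stable_product g' f qz qx)).
by congr integral; apply: funext => y; rewrite mulrA -mulrDl.
Qed.

Lemma perm_compr a b c (s : k) (g : perm_hom k (coset_set b) (coset_set c))
    (f f' : perm_hom k (coset_set a) (coset_set b)) :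
  perm_comp t g (s *: f + f') = s *: perm_comp t g f + perm_comp t g f'.
Proof.
apply/val_inj/funext => -[z x].
have [q [qz qx]] := fin_stab_upto2 z x.
rewrite /= -[RHS]/(s * perm_comp_val t g f (z, x) + perm_comp_val t g f' (z, x)).
rewrite /perm_comp_val /= -(integral_linear char0 n1 t s
  (stable_product g f qz qx) (stable_product g f' qz qx)).
by congr integral; apply: funext => y; rewrite mulrCA -mulrDr.
Qed.

Lemma inf_schur_mul_bilinear : bilinear_product (@inf_schur_mul k n t).
Proof.
by apply: hom_sum_mul_bilinear => a b c s *; [exact: perm_compl|exact: perm_compr].
Qed.

(** The total [t] and the tail determine the first entry. *)
Lemma tail_inj : injective (@tail k n t).
Proof.
move=> b b' bb'; apply: val_inj.
have /asboolP[_ _ _ sb] := valP b; have /asboolP[_ _ _ sb'] := valP b'.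
move: sb sb' bb'; rewrite /tail; case: (val b) (val b') => [x f] [x' f'] /=.
by move=> fx fx' ff'; move: fx; rewrite ff' -fx' => /addIr ->.
Qed.

End Bilinearity.

(** * Morphisms as matrices indexed by words of length d *)

Section Restriction.
Variables (k : fieldType) (n : option nat) (d : nat).
Hypothesis char0 : [pchar k] =i pred0.
Hypothesis n1 : in_range n 1.
Local Notation t := (d%:R : k).
Implicit Types a b c : weight n t.

Definition entry a b (f : perm_hom k (coset_set a) (coset_set b))
  (w v : nat -> nat) : k := f (word_coset b w, word_coset a v).

Lemma entry_linear a b (s : k) (f g : perm_hom k (coset_set a) (coset_set b)) w v :
  entry (s *: f + g) w v = s * entry f w v + entry g w v.
Proof. by []. Qed.

Lemma word_coset_fixed b w g : coset_words b d w -> stab_upto d g ->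
  fin_act g (word_coset b w) = word_coset b w.
Proof.
move=> wd; apply: (proj2 (coset_word_fixed n1 d _)).
by rewrite (word_cosetK n1 wd).
Qed.

(** Both outer cosets are fixed by [stab_upto d], so the integrand is stable for q = d, the largest
    value that [integral_sum] allows. *)
Lemma entry_comp a b c (g : perm_hom k (coset_set b) (coset_set c))
    (f : perm_hom k (coset_set a) (coset_set b)) w v :
    coset_words c d w -> coset_words a d v ->
  entry (perm_comp t g f) w v =
  \sum_(u \in coset_words b d) entry g w u * entry f u v.
Proof.
move=> wd vd; rewrite /entry /= /perm_comp_val /=.
rewrite (@integral_sum _ _ _ b char0 n1 d d) //; apply: stable_product => h hd.
  exact: word_coset_fixed.
exact: word_coset_fixed.
Qed.

Lemma trace_sum a (f : perm_hom k (coset_set a) (coset_set a)) :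
  perm_trace t f = \sum_(w \in coset_words a d) entry f w w.
Proof.
apply: (@integral_sum _ _ _ a char0 n1 0 d (fun x => f (x, x))) => // h x _.
exact: perm_hom_act.
Qed.

(** Two words are read as one word in pairs of colours, with trivial letter (1, 1). Conjugate pairs
    have equal multiplicities of the other letters, hence differ by a permutation of the d
    places. *)
Lemma coset_words_equivalent a b (g : symN) w v w' v' :
    coset_words b d w -> coset_words a d v ->
    coset_words b d w' -> coset_words a d v' ->
    word_coset b w' = fin_act g (word_coset b w) ->
    word_coset a v' = fin_act g (word_coset a v) ->
  exists s : 'S_d, w' = w \o perm_nat s /\ v' = v \o perm_nat s.
Proof.
move=> wd vd wd' vd' ww' vv'.
have {}ww' : w' = w \o sym_inv g.
  by rewrite -(word_cosetK n1 wd') ww' coset_word_act// (word_cosetK n1 wd).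
have {}vv' : v' = v \o sym_inv g.
  by rewrite -(word_cosetK n1 vd') vv' coset_word_act// (word_cosetK n1 vd).
have [x dx|c c1|s sE] := @perm_nat_letters _ (fun x => (w x, v x))
    (fun x => (w' x, v' x)) d (1, 1)%N.
- by rewrite (coset_words_supp wd)// (coset_words_supp vd)//
    (coset_words_supp wd')// (coset_words_supp vd').
- apply: (@count_letters_sym _ _ _ _ _ _ g) => x.
  + by rewrite ww' vv' /= sym_funK.
  + move=> dx; rewrite (coset_words_supp wd)// (coset_words_supp vd)//.
    by move/esym/eqP; exact/negP.
  + move=> dx; rewrite (coset_words_supp wd')// (coset_words_supp vd')//.
    by move/esym/eqP; exact/negP.
exists s; split; apply: funext => x /=.
  by have [] := sE x.
by have [] := sE x.
Qed.

Lemma entry_perm a b (f : perm_hom k (coset_set a) (coset_set b)) w v (s : 'S_d) :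
    coset_words b d w -> coset_words a d v ->
  entry f (w \o perm_nat s) (v \o perm_nat s) = entry f w v.
Proof.
move=> wd vd; rewrite /entry.
rewrite (word_coset_sym n1 (r := d) (g := symN_perm s) wd) => [|x dx]; last first.
  by rewrite /= perm_nat_ge// (coset_words_supp wd).
rewrite (word_coset_sym n1 (r := d) (g := symN_perm s) vd) => [|x dx]; last first.
  by rewrite /= perm_nat_ge// (coset_words_supp vd).
exact: perm_hom_act.
Qed.

Definition orbit_indicator_val (X Y : finitary_set) (x0 : X) (y0 : Y) :
    Y * X -> k^o :=
  fun yx => (`[< exists g, fin_act g y0 = yx.1 /\ fin_act g x0 = yx.2 >])%:R.

Lemma orbit_indicator_constant (X Y : finitary_set) (x0 : X) (y0 : Y) :
  orbit_indicator_val x0 y0 \in @orbit_constant k X Y.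
Proof.
apply/asboolP => h y x; rewrite /orbit_indicator_val /=; congr (nat_of_bool _)%:R.
apply/asbool_equiv_eq; split=> -[g [gy gx]].
  by exists (h^-1 * g)%g; rewrite !fin_actM gy gx !fin_actK.
by exists (h * g)%g; rewrite !fin_actM gy gx.
Qed.

Definition orbit_indicator (X Y : finitary_set) (x0 : X) (y0 : Y) :
  perm_hom k X Y := PermHom (orbit_indicator_constant x0 y0).

(** If the entries vanish, so do all terms of the traces. Conversely, [f] is tested against the
    indicator of the orbit of (v0, w0): the trace is [entry f w0 v0] times the number of pairs of
    words in that orbit, a positive integer and so nonzero in [k]. *)
Lemma negligibleP a b (f : perm_hom k (coset_set a) (coset_set b)) :
  negligible t f <->
  forall w v, coset_words b d w -> coset_words a d v -> entry f w v = 0.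
Proof.
split=> [fn w0 v0 w0d v0d|f0 g]; last first.
  rewrite !trace_sum; split; apply: fsbig1 => w wd.
    by rewrite entry_comp//; apply: fsbig1 => v vd; rewrite f0// mul0r.
  by rewrite entry_comp//; apply: fsbig1 => v vd; rewrite f0// mulr0.
pose g := orbit_indicator (word_coset b w0) (word_coset a v0).
have [+ _] := fn g; rewrite trace_sum.
have fWb := coset_words_finite b n1 d; have fWa := coset_words_finite a n1 d.
have gE w v : coset_words b d w -> coset_words a d v ->
    entry f w v * entry g v w = entry f w0 v0 * entry g v w.
  move=> wd vd; rewrite [entry g _ _]/=/orbit_indicator_val /=.
  case: asboolP => [[h [hv hw]]|_]; last by rewrite !mulr0.
  by rewrite /entry -hv -hw perm_hom_act.
rewrite (_ : \sum_(w \in _) _ = entry f w0 v0 *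
    (\sum_(w <- fset_set (coset_words b d)) \sum_(v <- fset_set (coset_words a d))
      `[< exists h, fin_act h (word_coset a v0) = word_coset a v /\
        fin_act h (word_coset b w0) = word_coset b w >])%N%:R); last first.
  rewrite fsbig_finite// natr_sum mulr_sumr; apply: eq_big_seq => w.
  rewrite in_fset_set// => /set_mem wd; rewrite entry_comp//.
  rewrite fsbig_finite// natr_sum mulr_sumr; apply: eq_big_seq => v.
  by rewrite in_fset_set// => /set_mem vd; rewrite gE.
move=> /eqP; rewrite mulf_eq0 => /orP[/eqP//|]; rewrite char0_natr_eq0//.
rewrite (bigD1_seq w0) ?in_fset_set ?mem_set ?fset_uniq//.
rewrite (bigD1_seq v0) ?in_fset_set ?mem_set ?fset_uniq//.
rewrite (_ : `[< _ >] = true)//.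
by apply/asboolP; exists 1%g; rewrite !fin_act1.
Qed.

(* The value at a pair of cosets is read off any pair of words of length d in
   its orbit; by coset_words_equivalent the choice does not matter. *)
Lemma entry_full a b (F : (nat -> nat) * (nat -> nat) -> k) :
    (forall (s : 'S_d) w v, F (w \o perm_nat s, v \o perm_nat s) = F (w, v)) ->
  exists f : perm_hom k (coset_set a) (coset_set b),
    forall w v, coset_words b d w -> coset_words a d v -> entry f w v = F (w, v).
Proof.
move=> Finv.
pose P (yx : coset_set b * coset_set a) : set ((nat -> nat) * (nat -> nat)) :=
  [set wv | [/\ coset_words b d wv.1, coset_words a d wv.2 &
    exists g, fin_act g yx.1 = word_coset b wv.1 /\
      fin_act g yx.2 = word_coset a wv.2]].
(* The value depends on the pair of cosets only through the set [P yx], so constancy on orbits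
   becomes an equality of sets. Orbits that contain no pair of words of length d get 0. *)
pose val_at (S : set ((nat -> nat) * (nat -> nat))) : k :=
  let wv := xget ((id, id) : (nat -> nat) * (nat -> nat)) S in
  if `[< S wv >] then F wv else 0.
have fc : (fun yx => val_at (P yx)) \in @orbit_constant k (coset_set a) (coset_set b).
  apply/asboolP => h y x; congr (val_at _); apply/seteqP.
  split=> -[w v] [wd vd [g [gy gx]]]; split=> //.
    by exists (g * h)%g; split; rewrite fin_actM.
  exists (g * h^-1)%g; split; [rewrite -[RHS]gy|rewrite -[RHS]gx].
    by rewrite fin_actM; congr fin_act; exact: fin_actK.
  by rewrite fin_actM; congr fin_act; exact: fin_actK.
exists (PermHom fc) => w v wd vd; rewrite /entry /= /val_at.
case: xgetP => [[w' v'] _ [/= wd' vd' [g [gw gv]]]|/(_ (w, v)) []]; last first.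
  by split=> //; exists 1%g; split; rewrite fin_act1.
rewrite asboolT; last by split=> //=; exists g.
have [s [-> ->]] := coset_words_equivalent wd vd wd' vd' (esym gw) (esym gv).
exact: Finv.
Qed.

End Restriction.

(** * Algebras of matrices indexed by words *)

Section WordFunctions.
Variables (k : fieldType) (d : nat) (R : set (nat -> nat)).
Local Notation word := (nat -> nat).

(** One ambient space for the matrices of all the algebras to be compared. *)
Definition word_fun : lmodType k := (word * word -> k^o) : lmodType k.

Definition word_mul (F G : word_fun) : word_fun :=
  fun wu => \sum_(v \in R) F (wu.1, v) * G (v, wu.2).

(** The common image of the models. Finiteness of the support matters for infinite n, where [R] may
    be infinite while an element has finitely many nonzero components. *)
Definition word_invariant : set word_fun := [set F |
  [/\ forall (s : 'S_d) w u, F (w \o perm_nat s, u \o perm_nat s) = F (w, u),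
      finite_set [set wu | F wu != 0]
    & forall w u, F (w, u) != 0 -> R w /\ R u]].

End WordFunctions.

Section HomSumModel.
Variables (k : fieldType) (d : nat) (C : hom_system k).
Local Notation word := (nat -> nat).
Variables (R : set word) (ty : word -> ob C).
Variable ev : forall a b : ob C, Defs.hom a b -> word -> word -> k.

Local Notation W b := (R `&` ty @^-1` [set b]).

Hypothesis R_perm : forall (s : 'S_d) w, R w -> R (w \o perm_nat s).
Hypothesis ty_perm : forall (s : 'S_d) w, R w -> ty (w \o perm_nat s) = ty w.
Hypothesis W_finite : forall b, finite_set (W b).
Hypothesis ev_linear : forall a b (s : k) (f g : Defs.hom a b) w v,
  ev (s *: f + g) w v = s * ev f w v + ev g w v.
Hypothesis ev_comp : forall a b c (g : Defs.hom b c) (f : Defs.hom a b) w v,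
  W c w -> W a v -> ev (hcomp g f) w v = \sum_(u \in W b) ev g w u * ev f u v.
Hypothesis ev_perm : forall a b (f : Defs.hom a b) (s : 'S_d) w v,
  W b w -> W a v -> ev f (w \o perm_nat s) (v \o perm_nat s) = ev f w v.
Hypothesis ev_full : forall a b (F : word * word -> k),
    (forall (s : 'S_d) w v, F (w \o perm_nat s, v \o perm_nat s) = F (w, v)) ->
  exists f : Defs.hom a b, forall w v, W b w -> W a v -> ev f w v = F (w, v).

(** A block matrix: [ty] names the object a word belongs to, rows come from the target and columns
    from the source of a component, and [ev] reads off entries. *)
Definition model (x : hom_sum C) : word_fun k := fun wu =>
  if `[< R wu.1 /\ R wu.2 >] then ev (dsum_val x (ty wu.2, ty wu.1)) wu.1 wu.2
  else 0.

Lemma modelE x w u : R w -> R u -> model x (w, u) = ev (dsum_val x (ty u, ty w)) w u.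
Proof. by move=> Rw Ru; rewrite /model asboolT. Qed.

Lemma model_out x w u : ~ (R w /\ R u) -> model x (w, u) = 0.
Proof. by move=> h; rewrite /model asboolF. Qed.

Lemma ev0 a b w v : ev (0 : Defs.hom a b) w v = 0.
Proof.
have := ev_linear 1 (0 : Defs.hom a b) 0 w v; rewrite scaler0 addr0 mul1r.
by rewrite -[LHS]addr0 => /addrI/esym.
Qed.

Lemma evD a b (f g : Defs.hom a b) w v : ev (f + g) w v = ev f w v + ev g w v.
Proof. by rewrite -[f in LHS]scale1r ev_linear mul1r. Qed.

Lemma ev_sum a b (I : Type) (r : seq I) (f : I -> Defs.hom a b) w v :
  ev (\sum_(i <- r) f i) w v = \sum_(i <- r) ev (f i) w v.
Proof. by elim: r => [|i r IH]; rewrite ?big_nil ?ev0// !big_cons evD IH. Qed.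

Lemma model_linear (s : k) x y : model (s *: x + y) = s *: model x + model y.
Proof.
apply: funext => -[w u]; rewrite -[RHS]/(s * model x (w, u) + model y (w, u)).
have [[Rw Ru]|nR] := pselect (R w /\ R u); last by rewrite !model_out// mulr0 addr0.
rewrite !modelE//; exact: ev_linear.
Qed.

(** The sum over intermediate objects b and the sum over words of type b merge into one sum over
    [R]. *)
Lemma model_mul x y : model (hom_sum_mul x y) = word_mul R (model x) (model y).
Proof.
apply: funext => -[w u]; rewrite /word_mul /=.
have [[Rw Ru]|nR] := pselect (R w /\ R u); last first.
  rewrite model_out//; apply/esym/fsbig1 => v Rv.
  have [Rw|nRw] := pselect (R w); last by rewrite model_out ?mul0r// => -[].
  by rewrite (@model_out y) ?mulr0// => -[_ Ru]; exact: nR.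
rewrite modelE//=; have /asboolP finy := dsum_finite y.
set a := ty u; set c := ty w.
have finX : finite_set (snd @` [set i | dsum_val y i != 0]) by exact: finite_image.
pose X := fset_set (snd @` [set i | dsum_val y i != 0]).
have y0 b : b \notin X -> dsum_val y (a, b) = 0.
  rewrite in_fset_set// => /negP nX; apply: contrapT => /eqP nz; apply: nX.
  by rewrite inE; exists (a, b).
rewrite /hom_sum_mul_val /= (fsbigTE X); last first.
  by move=> b bX; rewrite y0// hcomp0r.
rewrite ev_sum.
(* Only words whose type is the target of a nonzero component of y can contribute; this makes the
   sum over [R] finite before it is split by type. *)
pose V := R `&` ty @^-1` [set` X].
have finV : finite_set V.
  have -> : V = \bigcup_(b in [set` X]) W b.
    apply/seteqP; split=> [v [Rv tv]|v [b Xb [Rv vb]]]; first by exists (ty v).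
    by split=> //; rewrite /preimage /= vb.
  by apply: bigcup_finite => // b _.
rewrite -(fsbig_widen V R); last 2 first.
- by move=> v [].
- move=> v [Rv nV]; rewrite /preimage /= (modelE y)// y0 ?ev0 ?mulr0//.
  by apply/negP => tv; apply: nV.
rewrite (@fsbig_partition _ _ _ _ _ V [set` X] ty)//; last by move=> v [].
rewrite -fsbig_seq//; apply: eq_big_seq => b bX.
rewrite ev_comp//; have -> : V `&` ty @^-1` [set b] = W b.
  apply/seteqP; split=> v; [by case=> -[]|case=> Rv tv].
  by split=> //; split=> //=; rewrite tv.
apply: eq_fsbigr => v /set_mem[Rv tv]; rewrite !modelE// -/a -/c.
by move: tv => /= ->.
Qed.

Lemma model_invariant x : word_invariant d R (model x).
Proof.
split.
- move=> s w u; have Rs v : R (v \o perm_nat s) <-> R v.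
    split=> [/(R_perm s^-1%g)|]; last exact: R_perm.
    rewrite (_ : (v \o _) \o _ = v)//; apply: funext => z /=.
    by rewrite perm_natVK.
  have [[Rw Ru]|nR] := pselect (R w /\ R u); last first.
    by rewrite !model_out// => -[/Rs ? /Rs ?]; exact: nR.
  by rewrite !modelE//; [rewrite !ty_perm// ev_perm|exact/Rs|exact/Rs].
- have /asboolP finx := dsum_finite x.
  apply: (@sub_finite_set _ _
    (\bigcup_(i in [set i | dsum_val x i != 0]) (W i.2 `*` W i.1))).
    move=> [w u] /= xwu; have [[Rw Ru]|nR] := pselect (R w /\ R u); last first.
      by rewrite model_out ?eqxx in xwu.
    exists (ty u, ty w) => //=; apply/eqP => x0.
    by rewrite modelE// x0 ev0 eqxx in xwu.
  by apply: bigcup_finite => // i _; exact: finite_setX.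
move=> w u; apply: contra_neqP => nR; rewrite model_out//.
Qed.

Lemma model_surj F : word_invariant d R F -> exists x, model x = F.
Proof.
case=> Finv finF FR.
(* On blocks where [F] vanishes the preimage is chosen to be 0; an arbitrary choice could give a
   family of infinite support. *)
have H (i : ob C * ob C) : exists f : hom_family i,
    (forall w u, W i.2 w -> W i.1 u -> ev f w u = F (w, u)) /\
    (f != 0 -> exists w u, [/\ W i.2 w, W i.1 u & F (w, u) != 0]).
  have [[w [u wu]]|nF] := pselect (exists w u, [/\ W i.2 w, W i.1 u & F (w, u) != 0]).
    by have [f fF] := ev_full i.1 i.2 Finv; exists f; split=> // _; exists w, u.
  exists 0; split; last by rewrite eqxx.
  move=> w u Ww Wu; rewrite ev0; apply/esym/eqP/negPn/negP => Fwu.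
  by apply: nF; exists w, u.
pose f i := sval (cid (H i)); have fP i := svalP (cid (H i)).
have ffin : (f : Defs.dprod (@hom_family k C))
    \in @finitely_supported k _ (@hom_family k C).
  apply/asboolP; pose h (wu : word * word) := (ty wu.2, ty wu.1).
  apply: sub_finite_set (finite_image h finF) => -[a b] /= fi.
  have [_ /(_ fi)[w [u [[_ /= <-] [_ /= <-] Fwu]]]] := fP (a, b).
  by exists (w, u).
exists (DSum ffin); apply: funext => -[w u].
have [[Rw Ru]|nR] := pselect (R w /\ R u); last first.
  by rewrite model_out//; apply/esym/eqP/negPn/negP => /FR.
by rewrite modelE//; apply: (proj1 (fP (ty u, ty w))).
Qed.

Lemma model_eq0 x : model x = 0 <->
  forall a b w v, W b w -> W a v -> ev (dsum_val x (a, b)) w v = 0.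
Proof.
split=> [x0 a b w v [Rw <-] [Rv <-]|x0]; first by rewrite -modelE// x0.
apply: funext => -[w v]; have [[Rw Rv]|nR] := pselect (R w /\ R v).
  by rewrite modelE//; apply: x0.
by rewrite model_out.
Qed.

End HomSumModel.

(** The algebras are compared inside [V]: [f] and [g] have the same image [S] and [g] is injective,
    so [g^-1 f] makes sense, and it descends to a bijection because [f] has kernel [I]. *)
Lemma quotient_iso (k : fieldType) (A : algebra k) (I : {pred A})
    (hI : two_sided_ideal I) (B : algebra k) (V : lmodType k)
    (m : V -> V -> V) (S : set V) (f : A -> V) (g : B -> V) :
    (forall (s : k) x y, f (s *: x + y) = s *: f x + f y) ->
    (forall (s : k) x y, g (s *: x + y) = s *: g x + g y) ->
    (forall x y, f (amul x y) = m (f x) (f y)) ->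
    (forall x y, g (amul x y) = m (g x) (g y)) ->
    (forall x, S (f x)) -> (forall v, S v -> exists x, f x = v) ->
    (forall x, S (g x)) -> (forall v, S v -> exists x, g x = v) ->
    (forall x, x \in I <-> f x = 0) -> injective g ->
  algebra_iso (quotient_algebra hI) B.
Proof.
move=> flin glin fmul gmul fS Sf gS Sg fI ginj.
have fB x y : f (x - y) = f x - f y by rewrite addrC -scaleN1r flin scaleN1r addrC.
have [h hE] := choice (fun u : quotient_algebra hI => Sg _ (fS (repr u))).
have hpi x : g (h (\pi_(quotient_space hI) x)%qT) = f x.
  rewrite hE; apply/eqP; rewrite -subr_eq0 -fB; apply/eqP/fI.
  exact: quotient_reprP.
have hlin : linear h.
  move=> s u v; apply: ginj; rewrite glin -(reprK u) -(reprK v).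
  rewrite [_ *: _](quotient_scale_pi hI) -(Defs.pi_add hI) !hpi.
  by rewrite flin.
pose hL := GRing.isLinear.Build k (quotient_algebra hI) B *:%R h hlin.
pose phi : {linear quotient_algebra hI -> B} := HB.pack h hL.
exists phi; split; last first.
  move=> u v /=; apply: ginj; rewrite gmul -(reprK u) -(reprK v).
  by rewrite (quotient_mul_pi hI) !hpi fmul.
rewrite -setTT_bijective; split=> // [u v _ _ uv|y _].
  rewrite -(reprK u) -(reprK v); apply/quotient_eqP/fI.
  by rewrite fB -!hpi !reprK [h u]uv subrr.
have [x xy] := Sf _ (gS y).
by exists (\pi_(quotient_space hI) x)%qT => //; apply: ginj; rewrite hpi.
Qed.

Lemma sum_count_mem_ord (s : seq nat) (K : nat) :
  all (fun x => x < K)%N s -> (\sum_(i < K) count_mem (i : nat) s)%N = size s.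
Proof.
elim: s => [_|x s IH /= /andP[xK sK]]; first by rewrite big1.
rewrite big_split/= IH// (bigD1 (Ordinal xK))//= eqxx big1 ?addn0// => i.
by rewrite -val_eqE /= eq_sym => /negPf->.
Qed.

Lemma fsbig_ord_widen (V : nmodType) (F : nat -> V) (K : nat) :
  (forall i, (K <= i)%N -> F i = 0) -> \sum_(i \in setT) F i = \sum_(i < K) F i.
Proof.
move=> F0; rewrite fsbig_ord; apply/esym/fsbig_widen => // i [_ /= iK].
by apply: F0; rewrite leqNgt; apply/negP.
Qed.

Lemma count_letters0 (w : nat -> nat) (d i : nat) :
  (forall x, w x <> i) -> count_mem i (letters w d) = 0%N.
Proof.
move=> wi; apply/eqP; rewrite eqn0Ngt -has_count; apply/hasPn.
by move=> _ /mapP[x _ ->] /=; apply/eqP/wi.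
Qed.

Lemma count_letters_bound (w : nat -> nat) (d K i : nat) :
    (forall x, (w x < K)%N) -> (K <= i)%N ->
  count_mem i (letters w d) = 0%N.
Proof. by move=> wK Ki; apply: count_letters0 => x wx; have := wK x; lia. Qed.

(** * The matrix model of the infinite Schur algebra *)

Section PlaceWords.
Variables (n : option nat) (d : nat).
Hypothesis n1 : in_range n 1.

(** The padding agrees with the colour of the infinite block, so the same words code cosets of
    infinite and of finite Young subgroups. *)
Definition place_words : set (nat -> nat) :=
  [set w | (forall x, in_range n (w x)) /\ forall x, (d <= x)%N -> w x = 1%N].

Lemma place_words_perm (s : 'S_d) w :
  place_words w -> place_words (w \o perm_nat s).
Proof.
by move=> [wn wd]; split=> x /=; [exact: wn|move=> dx; rewrite perm_nat_ge// wd].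
Qed.

Lemma letters_perm (s : 'S_d) (w : nat -> nat) i :
  count_mem i (letters (w \o perm_nat s) d) = count_mem i (letters w d).
Proof.
have inj u : injective (@perm_nat d u) by exact: can_inj (perm_natK u).
have lt u x : (x < d)%N -> (@perm_nat d u x < d)%N.
  by move=> xd; rewrite -[x]/(val (Ordinal xd)) perm_nat_ord ltn_ord.
apply/eqP; rewrite eqn_leq; apply/andP; split.
  by apply: (@count_letters_le _ _ _ _ _ _ (perm_nat s)) => // x /lt.
apply: (@count_letters_le _ _ _ _ _ _ (perm_nat s^-1%g)) => // x xd wx.
by rewrite /= perm_natVK lt.
Qed.

Lemma place_words_bound w : place_words w ->
  exists2 K, (2 <= K)%N & forall x, (w x < K)%N.
Proof.
move=> [_ wd]; exists (\max_(i < d) w i).+2 => // x; rewrite ltnS.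
have [dx|xd] := leqP d x; first by rewrite wd.
by apply: leqW; apply: (leq_bigmax (Ordinal xd)).
Qed.

Lemma sum_letters (w : nat -> nat) (K : nat) : (forall x, (w x < K)%N) ->
  (\sum_(i < K) count_mem (i : nat) (letters w d))%N = d.
Proof.
move=> wK; rewrite sum_count_mem_ord ?size_map ?size_iota//.
by apply/allP => _ /mapP[x _ ->].
Qed.

Section Weights.
Variable k : fieldType.
Hypothesis char0 : [pchar k] =i pred0.
Local Notation t := (d%:R : k).

Definition word_tail (w : nat -> nat) (i : nat) : nat :=
  if (2 <= i)%N then count_mem i (letters w d) else 0%N.

Definition word_weight_val (w : nat -> nat) : k * (nat -> nat) :=
  ((count_mem 1%N (letters w d))%:R, word_tail w).

Lemma word_is_weight w : place_words w -> is_weight n t (word_weight_val w).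
Proof.
move=> wR; have [K K2 wK] := place_words_bound wR; have [wn wd] := wR.
have tailK i : (K <= i)%N -> word_tail w i = 0%N.
  by move=> Ki; rewrite /word_tail; case: ifP => // _; exact: count_letters_bound Ki.
split=> /=.
- exists (Posz (d - count_mem 1%N (letters w d))).
  have le : (count_mem 1%N (letters w d) <= d)%N.
    by rewrite -[leqRHS](size_iota 0) -(size_map w) count_size.
  by rewrite -pmulrn natrB// opprB addrC subrK.
- move=> i; rewrite /word_tail; case: ifP => // i2 /eqP cnt /=.
  apply/negPn/negP => ni; apply: cnt; apply: count_letters0 => x wx.
  by rewrite -wx wn in ni.
- apply: sub_finite_set (finite_II K) => i /= /eqP ti.
  by rewrite ltnNge; apply/negP => /tailK.
rewrite (@fsbig_ord_widen _ _ K) => [|i /tailK ->//].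
rewrite -{2}(sum_letters wK) natr_sum.
case: K K2 wK tailK => [|[|K]]// _ wK _.
rewrite !big_ord_recl /= !add0r addrA; congr (_ + _).
by rewrite (@count_letters0 _ _ 0%N) ?add0r// => x wx; have := wn x; rewrite wx.
Qed.

Fact default_place_word : place_words (fun=> 1%N).
Proof. by split. Qed.

(** The weight of the constant word is the default that [insubd] returns when the counts do not form
    a weight. *)
Definition word_weight (w : nat -> nat) : weight n t :=
  insubd (Sub (word_weight_val (fun=> 1%N))
           (asboolT (word_is_weight default_place_word)) : weight n t)
         (word_weight_val w).

Lemma tail_word_weight w : place_words w -> tail (word_weight w) = word_tail w.
Proof.
move=> wR; rewrite /tail /word_weight val_insubd ifT//.
exact/asboolP/word_is_weight.
Qed.

(** The words of length d split by weight, the colour 0 being excluded by the range. A weight whose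
    tail sums to more than d has no such word, so its object becomes zero in the quotient. *)
Lemma coset_wordsE (b : weight n t) :
  coset_words b d = place_words `&` word_weight @^-1` [set b].
Proof.
apply/seteqP; split=> w.
  move=> wb; have wR : place_words w.
    by split=> [x|]; [exact: (coset_words_range n1 x wb)|case: wb].
  split=> //; apply: tail_inj; rewrite tail_word_weight//; apply: funext => i.
  have [_ cnt] := wb; rewrite /word_tail; case: ifPn => i2; first by apply: cnt; lia.
  by rewrite tail_out// (negPf i2).
move=> [wR <-]; have [wn wd] := wR; split=> // i i1.
rewrite tail_word_weight// /word_tail; case: ifPn => // i2.
have -> : i = 0%N by lia.
by apply: count_letters0 => x wx; have := wn x; rewrite wx.
Qed.

Lemma word_weight_perm (s : 'S_d) w : place_words w ->
  word_weight (w \o perm_nat s) = word_weight w.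
Proof.
move=> wR; apply: tail_inj; rewrite !tail_word_weight//; last exact: place_words_perm.
by apply: funext => i; rewrite /word_tail letters_perm.
Qed.

Local Notation C := (perm_system n t).

Definition inf_schur_model : inf_schur n t -> word_fun k :=
  @model k C place_words word_weight
    (fun (a b : ob C) (f : Defs.hom a b) =>
      entry (f : perm_hom k (coset_set a) (coset_set b))).

Lemma place_words_finite (b : weight n t) :
  finite_set (place_words `&` word_weight @^-1` [set b]).
Proof. by rewrite -coset_wordsE; exact: coset_words_finite. Qed.

Lemma inf_schur_model_linear (s : k) x y :
  inf_schur_model (s *: x + y) = s *: inf_schur_model x + inf_schur_model y.
Proof. by apply: model_linear => *; exact: entry_linear. Qed.

Lemma inf_schur_model_mul x y : inf_schur_model (inf_schur_mul x y) =
  word_mul place_words (inf_schur_model x) (inf_schur_model y).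
Proof.
apply: model_mul => [b|a b s f g w v|a b c g f w v].
- exact: place_words_finite.
- exact: entry_linear.
- by rewrite -!coset_wordsE; exact: entry_comp.
Qed.

Lemma inf_schur_model_invariant x :
  word_invariant d place_words (inf_schur_model x).
Proof.
apply: model_invariant => [s w|s w|b|a b s f g w v|a b f s w v].
- exact: place_words_perm.
- exact: word_weight_perm.
- exact: place_words_finite.
- exact: entry_linear.
- by rewrite -!coset_wordsE; exact: entry_perm.
Qed.

Lemma inf_schur_model_surj F : word_invariant d place_words F ->
  exists x, inf_schur_model x = F.
Proof.
move=> FI; apply: model_surj FI => [a b s f g w v|a b G].
  exact: entry_linear.
move=> /(entry_full n1 a b)[f fG]; exists f => w v.
by rewrite -!coset_wordsE; exact: fG.
Qed.

Lemma negligible_idealP x :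
  x \in @negligible_ideal k n t <-> inf_schur_model x = 0.
Proof.
rewrite /inf_schur_model model_eq0.
split=> [/asboolP xn a b w v|x0].
  by rewrite -!coset_wordsE; apply: (proj1 (negligibleP char0 n1 _)).
apply/asboolP => a b; apply/(negligibleP char0 n1) => w v wb va.
by apply: x0; rewrite -coset_wordsE.
Qed.

(** The negligible morphisms form the kernel of a linear map that respects products. *)
Lemma negligible_two_sided (mul_bilinear : bilinear_product (@inf_schur_mul k n t)) :
  @two_sided_ideal k (inf_schur_algebra mul_bilinear) (@negligible_ideal k n t).
Proof.
have modelB0 : inf_schur_model 0 = 0.
  have := inf_schur_model_linear 1 0 0; rewrite scaler0 addr0 scale1r.
  by rewrite -[LHS]addr0 => /addrI/esym.
split; first split.
- exact/negligible_idealP.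
- move=> s x y /negligible_idealP x0 /negligible_idealP y0.
  by apply/negligible_idealP; rewrite inf_schur_model_linear x0 y0 scaler0 addr0.
move=> x y /negligible_idealP y0; split; apply/negligible_idealP.
  rewrite [LHS]inf_schur_model_mul y0; apply: funext => wu.
  by apply: fsbig1 => v _; rewrite mulr0.
rewrite [LHS]inf_schur_model_mul y0; apply: funext => wu.
by apply: fsbig1 => v _; rewrite mul0r.
Qed.

End Weights.
End PlaceWords.

(** * The classical Schur algebra *)

Section Coefficients.
Variables (k : fieldType) (d : nat).

(** The matrix entry of [f] in the standard bases. *)
Definition coef (X Y : finType) (toX : {action 'S_d &-> X})
    (toY : {action 'S_d &-> Y}) (f : equi_hom k toX toY) (y : Y) (x : X) : k :=
  (f [ffun x' => (x' == x)%:R] : {ffun Y -> k}) y.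

Section Pair.
Variables (X Y : finType) (toX : {action 'S_d &-> X}) (toY : {action 'S_d &-> Y}).
Implicit Type f : equi_hom k toX toY.

Lemma equi_hom_coef f (v : perm_module k X) y :
  (f v : {ffun Y -> k}) y = \sum_x coef f y x * v x.
Proof.
have -> : v = \sum_x v x *: ([ffun x' => (x' == x)%:R] : perm_module k X).
  apply/ffunP => x'; rewrite sum_ffunE (bigD1 x')//= !ffunE eqxx.
  rewrite big1 ?addr0 => [|x /negPf xx']; first by rewrite [RHS]mulr1.
  by rewrite !ffunE eq_sym xx' [LHS]mulr0.
rewrite linear_sum /= sum_ffunE; apply: eq_bigr => x _.
rewrite linearZ ffunE sum_ffunE (bigD1 x)//= !ffunE eqxx big1 ?addr0.
  by rewrite /coef mulrC; congr (_ * _); rewrite [RHS]mulr1.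
by move=> x' /negPf xx'; rewrite !ffunE eq_sym xx' [LHS]mulr0.
Qed.

Lemma coef_linear (s : k) f g y x :
  coef (s *: f + g) y x = s * coef f y x + coef g y x.
Proof. by rewrite /coef /= !lfunE /= !lfunE /= !ffunE. Qed.

Lemma coef_inj f g : (forall y x, coef f y x = coef g y x) -> f = g.
Proof.
move=> fg; apply/val_inj/lfunP => v; apply/ffunP => y.
by rewrite [LHS]equi_hom_coef [RHS]equi_hom_coef; apply: eq_bigr => x _; rewrite fg.
Qed.

Lemma coef_act f (s : 'S_d) y x : coef f (toY y s) (toX x s) = coef f y x.
Proof.
rewrite /coef; have /asboolP fe := equi_homP f.
have -> : [ffun x' => (x' == toX x s)%:R] =
    perm_module_act toX s [ffun x' => (x' == x)%:R] :> perm_module k X.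
  by apply/ffunP => x'; rewrite !ffunE -(inj_eq (act_inj toX s^-1%g)) actK.
by rewrite fe ffunE actK.
Qed.

Lemma coef_surj (M : Y -> X -> k) :
    (forall (s : 'S_d) y x, M (toY y s) (toX x s) = M y x) ->
  exists f, forall y x, coef f y x = M y x.
Proof.
move=> Mact; pose h (v : perm_module k X) : perm_module k Y :=
  [ffun y => \sum_x M y x * v x].
have hlin : linear h.
  move=> s u v; apply/ffunP => y; rewrite !ffunE.
  rewrite [X in _ = X + _]mulr_sumr -big_split; apply: eq_bigr => x _ /=.
  by rewrite !ffunE mulrDr [s *: _]/(s * _) mulrCA.
pose hL := GRing.isLinear.Build k (perm_module k X) (perm_module k Y) *:%R h hlin.
pose hl : {linear perm_module k X -> perm_module k Y} := HB.pack h hL.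
have fe : linfun hl \in equivariant toX toY.
  apply/asboolP => s v; rewrite !lfunE; apply/ffunP => y; rewrite !ffunE.
  rewrite (reindex_inj (act_inj toX s)); apply: eq_bigr => x _ /=.
  by rewrite ffunE actK -{1}(actKV toY s y) Mact.
exists (EquiHom fe) => y x; rewrite /coef lfunE ffunE.
rewrite (bigD1 x)//= ffunE eqxx mulr1 big1 ?addr0// => x' /negPf xx'.
by rewrite ffunE xx' mulr0.
Qed.

End Pair.

Lemma coef_comp (X Y Z : finType) (toX : {action 'S_d &-> X})
    (toY : {action 'S_d &-> Y}) (toZ : {action 'S_d &-> Z})
    (g : equi_hom k toY toZ) (f : equi_hom k toX toY) z x :
  coef (equi_comp g f) z x = \sum_y coef g z y * coef f y x.
Proof. by rewrite {1}/coef /= lfunE /= equi_hom_coef. Qed.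

End Coefficients.

(* The elements of a finite set with an action of S_d are coded by words; the
   code of a point is unique, so each of the sums below has at most one term. *)
Section CodedCoefficients.
Variables (k : fieldType) (d : nat).
Local Notation word := (nat -> nat).

Record coding (X : finType) (to : {action 'S_d &-> X}) (W : set word) := Coding {
  code :> X -> word;
  code_bij : set_bij setT W code;
  code_act : forall s x, code (to x s) = code x \o perm_nat s^-1%g
}.

Definition coded_coef (X Y : finType) (toX : {action 'S_d &-> X})
    (toY : {action 'S_d &-> Y}) (V W : set word) (cX : coding toX V)
    (cY : coding toY W) (f : equi_hom k toX toY) (w v : word) : k :=
  \sum_(y | cY y == w) \sum_(x | cX x == v) coef f y x.

Lemma code_inj (X : finType) (to : {action 'S_d &-> X}) W (c : coding to W) :
  injective c.
Proof. by case: (code_bij c) => _ inj _ x y; apply: inj; rewrite inE. Qed.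

Lemma code_surj (X : finType) (to : {action 'S_d &-> X}) W (c : coding to W) w :
  W w -> exists x, c x = w.
Proof. by case: (code_bij c) => _ _ /(_ w) /[apply] -[x _ <-]; exists x. Qed.

Lemma code_mem (X : finType) (to : {action 'S_d &-> X}) W (c : coding to W) x :
  W (c x).
Proof. by case: (code_bij c) => h _ _; exact: h. Qed.

Section Pair.
Variables (X Y : finType) (toX : {action 'S_d &-> X}) (toY : {action 'S_d &-> Y}).
Variables (V W : set word) (cX : coding toX V) (cY : coding toY W).
Implicit Type f : equi_hom k toX toY.

Lemma coded_coefE f y x : coded_coef cX cY f (cY y) (cX x) = coef f y x.
Proof.
rewrite /coded_coef (big_pred1 y) => [|y'].
  by rewrite (big_pred1 x) => [//|x']; exact: inj_eq (@code_inj _ _ _ cX) _ _.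
exact: inj_eq (@code_inj _ _ _ cY) _ _.
Qed.

Lemma coded_coef_linear (s : k) f g w v :
  coded_coef cX cY (s *: f + g) w v =
  s * coded_coef cX cY f w v + coded_coef cX cY g w v.
Proof.
rewrite /coded_coef mulr_sumr -big_split; apply: eq_bigr => y _ /=.
rewrite mulr_sumr -big_split; apply: eq_bigr => x _ /=.
exact: coef_linear.
Qed.

Lemma coded_coef_perm f (s : 'S_d) w v : W w -> V v ->
  coded_coef cX cY f (w \o perm_nat s) (v \o perm_nat s) =
  coded_coef cX cY f w v.
Proof.
move=> /(code_surj cY)[y <-] /(code_surj cX)[x <-].
by rewrite -[s]invgK -!code_act !coded_coefE coef_act.
Qed.

Lemma coded_coef_surj (F : word * word -> k) :
    (forall (s : 'S_d) w v, F (w \o perm_nat s, v \o perm_nat s) = F (w, v)) ->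
  exists f, forall w v, W w -> V v -> coded_coef cX cY f w v = F (w, v).
Proof.
move=> Finv; have [|f fM] := @coef_surj k _ _ _ toX toY (fun y x => F (cY y, cX x)).
  by move=> s y x; rewrite !code_act Finv.
exists f => _ _ /(code_surj cY)[y <-] /(code_surj cX)[x <-].
by rewrite coded_coefE fM.
Qed.

Lemma coded_coef_eq0 f :
  (forall w v, W w -> V v -> coded_coef cX cY f w v = 0) -> f = 0.
Proof.
move=> f0; apply: coef_inj => y x; rewrite -coded_coefE f0; try exact: code_mem.
by rewrite /coef /= lfunE ffunE.
Qed.

Lemma coded_coef_out f w v : ~ (W w /\ V v) -> coded_coef cX cY f w v = 0.
Proof.
move=> nWV; rewrite /coded_coef big1// => y /eqP yw; rewrite big1// => x /eqP xv.
by exfalso; apply: nWV; rewrite -yw -xv; split; exact: code_mem.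
Qed.

Lemma coding_finite : finite_set W.
Proof.
apply: (@sub_finite_set _ _ (cY @` setT)); last exact/finite_image/finite_finset.
by move=> w /(code_surj cY)[y <-]; exists y.
Qed.

End Pair.

Lemma coded_coef_comp (X Y Z : finType) (toX : {action 'S_d &-> X})
    (toY : {action 'S_d &-> Y}) (toZ : {action 'S_d &-> Z}) (U V W : set word)
    (cX : coding toX U) (cY : coding toY V) (cZ : coding toZ W)
    (g : equi_hom k toY toZ) (f : equi_hom k toX toY) w u : W w -> U u ->
  coded_coef cX cZ (equi_comp g f) w u =
  \sum_(v \in V) coded_coef cY cZ g w v * coded_coef cX cY f v u.
Proof.
move=> /(code_surj cZ)[z <-] /(code_surj cX)[x <-].
rewrite coded_coefE coef_comp (reindex_fsbig _ _ _ _ (code_bij cY)).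
rewrite -(fsbig_finType _ predT) (_ : [set` predT] = setT); last exact/seteqP.
by apply: eq_fsbigr => y _; rewrite !coded_coefE.
Qed.

End CodedCoefficients.

(** * Coding the basis of the tensor power *)

Section FiniteWords.
Variables (m d : nat).

(** The letters 0, ..., m - 1 become the colours 1, ..., m, and the default 1 is the padding from
    place d on. *)
Definition nat_word (u : words m d) (x : nat) : nat :=
  oapp (fun i : 'I_d => (u i).+1) 1%N (insub x).

Lemma nat_word_ord u (i : 'I_d) : nat_word u i = (u i).+1.
Proof. by rewrite /nat_word valK. Qed.

Lemma nat_word_ge u x : (d <= x)%N -> nat_word u x = 1%N.
Proof. by move=> dx; rewrite /nat_word insubF// ltnNge dx. Qed.

Lemma nat_word_bij : (0 < m)%N -> set_bij setT (place_words (Some m) d) nat_word.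
Proof.
move=> m0; split.
- move=> u _; split=> x; last exact: nat_word_ge.
  by rewrite /nat_word /in_range; case: insubP => [i _ _|_] /=.
- move=> u v _ _ uv; apply/ffunP => i; apply: val_inj; apply: succn_inj.
  by rewrite -!nat_word_ord uv.
(* The letters of [w] lie in [1, m], so their predecessors are below m and [insubd] never falls back
   on [Ordinal m0]. *)
move=> w [wn wd]; pose f (i : 'I_d) : 'I_m := insubd (Ordinal m0) (w i).-1.
exists (finfun f) => //; apply: funext => x.
have [xd|dx] := ltnP x d; last by rewrite nat_word_ge// wd.
rewrite -[x]/(val (Ordinal xd)) nat_word_ord ffunE val_insubd /=.
by have := wn x; rewrite /in_range => /andP[w0 wm]; rewrite ifT; lia.
Qed.

Lemma nat_word_act (s : 'S_d) u :
  nat_word (place_action m d u s) = nat_word u \o perm_nat s^-1%g.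
Proof.
apply: funext => x /=; have [xd|dx] := ltnP x d; last first.
  by rewrite perm_nat_ge// !nat_word_ge.
by rewrite -[x]/(val (Ordinal xd)) perm_nat_ord !nat_word_ord ffunE.
Qed.

Definition words_coding (m0 : (0 < m)%N) :
    coding (place_action m d) (place_words (Some m) d) :=
  Coding (nat_word_bij m0) (fun s u => nat_word_act s u).

End FiniteWords.

(** * Coding the cosets of the finite Young subgroups *)

Section FiniteCosetWords.
Variables (n : option nat) (d : nat).
Hypothesis n1 : in_range n 1.
Implicit Type b : composition n d.

Definition word_content (w : nat -> nat) (i : nat) : nat :=
  count_mem i (letters w d).

Lemma word_is_composition w : place_words n d w ->
  is_composition n d (word_content w).
Proof.
move=> wR; have [K K2 wK] := place_words_bound wR; have [wn wd] := wR.
split.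
- move=> i /eqP wi; apply/negPn/negP => ni; apply: wi; apply: count_letters0 => x wx.
  by rewrite -wx wn in ni.
- apply: sub_finite_set (finite_II K) => i /= /eqP wi.
  by rewrite ltnNge; apply/negP => /(count_letters_bound d wK).
rewrite (@fsbig_ord_widen _ _ K) => [|i /(count_letters_bound d wK)//].
exact: sum_letters.
Qed.

Definition word_composition (w : nat -> nat) : composition n d :=
  insubd (Sub (word_content (fun=> 1%N))
           (asboolT (word_is_composition (default_place_word d n1))) : composition n d)
         (word_content w).

Lemma val_word_composition w : place_words n d w ->
  val (word_composition w) = word_content w.
Proof.
move=> wR; rewrite val_insubd ifT//.
exact/asboolP/word_is_composition.
Qed.

Lemma word_composition_perm (s : 'S_d) w : place_words n d w ->
  word_composition (w \o perm_nat s) = word_composition w.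
Proof.
move=> wR; apply: val_inj; rewrite !val_word_composition//.
  by apply: funext => i; exact: letters_perm.
exact: place_words_perm.
Qed.

Section Coset.
Variable b : composition n d.

(** In [base_word] the colour 1 fills the complement of the tail; here the blocks begin with colour
    1, and the default 1 is reached only from place d on. *)
Definition fin_base_word : nat -> nat := interval_word 1 (val b).

Lemma composition0 : val b 0%N = 0%N.
Proof. by apply: contrapT => /eqP; have /asboolP[br _ _] := valP b => /br. Qed.

Lemma composition_partial_sums : exists2 M,
  (\sum_(1 <= j < M) val b j)%N = d &
  forall i, (\sum_(1 <= j < i) val b j <= \sum_(1 <= j < M) val b j)%N.
Proof.
have /asboolP[br /finite_seqP[s bs] bd] := valP b.
pose M := (\max_(i <- s) i).+1.
have b0 j : (M <= j)%N -> val b j = 0%N.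
  move=> Mj; apply/eqP/negPn/negP => nz.
  have js : j \in s by have : [set i | val b i != 0%N] j by []; rewrite bs.
  by move: Mj; rewrite ltnNge (@leq_bigmax_seq _ _ xpredT id).
have dE : (\sum_(1 <= j < M) val b j)%N = d.
  rewrite -[RHS]bd (@fsbig_ord_widen _ _ M)// big_ord_recl.
  by rewrite [X in _ = X + _]composition0 add0r big_add1 big_mkord.
by exists M => // i; exact: partial_sum_ge.
Qed.

Lemma fin_base_word_interval x : (x < d)%N ->
  interval_letter 1 (val b) (fin_base_word x) x.
Proof.
have [M dE _] := composition_partial_sums => xd.
have [|i ix] := @interval_letter_exists 1 (val b) M x; first by rewrite dE.
by rewrite /fin_base_word (interval_wordE ix).
Qed.

Lemma fin_base_word_ge x : (d <= x)%N -> fin_base_word x = 1%N.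
Proof.
move=> dx; case: (interval_wordP 1 (val b) x) => [/andP[_ xi]|[]//].
have [M dE le] := composition_partial_sums.
by have := le (interval_word 1 (val b) x).+1; lia.
Qed.

Lemma fin_base_word_range x : in_range n (fin_base_word x).
Proof.
have /asboolP[br _ _] := valP b; rewrite /fin_base_word.
case: (interval_wordP 1 (val b) x) => [|[-> //]].
by move=> /interval_letter_range/andP[_ /br].
Qed.

Lemma fin_base_word_mem :
  (place_words n d `&` word_composition @^-1` [set b]) fin_base_word.
Proof.
have wR : place_words n d fin_base_word.
  by split; [exact: fin_base_word_range|exact: fin_base_word_ge].
split=> //; apply: val_inj; rewrite val_word_composition//; apply: funext => i.
have [i0|i1] := posnP i.
  rewrite i0 composition0.
  by apply: count_letters0 => x x0; have := fin_base_word_range x; rewrite x0.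
have [M dE le] := composition_partial_sums.
apply: count_interval_word => [//||x xd <-]; first by rewrite -[leqRHS]dE.
exact: fin_base_word_interval.
Qed.

Lemma fin_youngE (s : 'S_d) :
  s \in fin_young b <-> forall x, fin_base_word (perm_nat s x) = fin_base_word x.
Proof.
have blockE (x : 'I_d) i : (x \in fin_block b i) = (fin_base_word x == i).
  rewrite inE; apply/idP/eqP => [|<-]; first exact: interval_wordE.
  exact: fin_base_word_interval.
rewrite inE; split=> [/asboolP sb x|sb].
  have [xd|dx] := ltnP x d; last by rewrite perm_nat_ge.
  rewrite -[x]/(val (Ordinal xd)) perm_nat_ord; apply/eqP; rewrite -blockE.
  by rewrite -(sb _ (fin_base_word_range _)) imset_f// blockE.
apply/asboolP => i ni; apply/eqP.
(* Injectivity of [s] reduces the equality of a block and its image to an inclusion. *)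
rewrite eqEcard card_imset ?leqnn ?andbT; last exact: perm_inj.
apply/fintype.subsetP => _ /imsetP[x xi ->].
by rewrite blockE -perm_nat_ord sb -blockE.
Qed.

(** The cosets are right cosets, and by [fin_coset_wordE] the word does not depend on the
    representative. *)
Definition fin_coset_word (C : fin_coset b) : nat -> nat :=
  fin_base_word \o perm_nat (fingroup.repr (val C))^-1%g.

Lemma fin_coset_wordE (C : fin_coset b) (s : 'S_d) :
  val C = (fin_young b :* s)%g -> fin_coset_word C = fin_base_word \o perm_nat s^-1%g.
Proof.
move=> Cs; have : fingroup.repr (val C) \in (fin_young b :* s)%g.
  by rewrite Cs; exact: mem_repr_rcoset.
rewrite /fin_coset_word => /rcosetP[y yb ->]; apply: funext => x /=.
by rewrite invMg perm_natM (proj1 (fin_youngE y^-1%g))// groupV.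
Qed.

Lemma fin_coset_wordP (C : fin_coset b) : exists2 s : 'S_d,
  val C = (fin_young b :* s)%g & fin_coset_word C = fin_base_word \o perm_nat s^-1%g.
Proof.
have /rcosetsP[s _ Cs] := valP C; exists s => //; exact: fin_coset_wordE.
Qed.

Lemma fin_coset_word_act s (C : fin_coset b) :
  fin_coset_word (fin_coset_action b C s) = fin_coset_word C \o perm_nat s^-1%g.
Proof.
have [u Cu ->] := fin_coset_wordP C; rewrite (@fin_coset_wordE _ (u * s)%g).
  by apply: funext => x /=; rewrite invMg perm_natM.
by rewrite /= Cu rcosetM.
Qed.

(** Injective because the Young subgroup is the stabilizer of the base word; surjective because
    words of equal content differ by a permutation of the d places. *)
Lemma fin_coset_word_bij : set_bij setT
  (place_words n d `&` word_composition @^-1` [set b]) fin_coset_word.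
Proof.
split.
- move=> C _; have [s _ ->] := fin_coset_wordP C.
  have [wR wb] := fin_base_word_mem; split; first exact: place_words_perm.
  by rewrite /preimage /= word_composition_perm.
- move=> C D _ _; have [s Cs ->] := fin_coset_wordP C.
  have [u Du ->] := fin_coset_wordP D => su; apply: val_inj; rewrite Cs Du.
  apply/rcoset_eqP/rcosetP; exists (s * u^-1)%g; last by rewrite mulgKV.
  apply/fin_youngE => x; rewrite perm_natM.
  by rewrite -[LHS](congr1 (@^~ (perm_nat s x)) su) /= perm_natK.
move=> w [wR wb]; have [_ wd] := wR; have [bR bb] := fin_base_word_mem.
have [x dx|i _|s sE] := @perm_nat_letters _ w fin_base_word d 1%N.
- by rewrite wd// fin_base_word_ge.
- have := congr1 (fun c => val c i) (etrans wb (esym bb)).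
  by rewrite /= !val_word_composition.
have Cs : (fin_young b :* s)%g \in rcosets (fin_young b) [set: 'S_d]%SET.
  by apply/rcosetsP; exists s; rewrite ?inE.
exists (Sub (fin_young b :* s)%g Cs : fin_coset b) => //.
rewrite (@fin_coset_wordE _ s)//.
by apply: funext => x /=; rewrite -sE perm_natVK.
Qed.

Definition fin_coset_coding : coding (fin_coset_action b)
    (place_words n d `&` word_composition @^-1` [set b]) :=
  Coding fin_coset_word_bij fin_coset_word_act.

End Coset.

Variable k : fieldType.
Local Notation C := (young_system k n d).

Definition schur_sum_model : schur_sum k n d -> word_fun k :=
  @model k C (place_words n d) word_composition
    (fun (a b : ob C) (f : Defs.hom a b) => coded_coef (fin_coset_coding a)
      (fin_coset_coding b)
      (f : equi_hom k (fin_coset_action a) (fin_coset_action b))).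

Lemma schur_sum_model_linear (s : k) x y :
  schur_sum_model (s *: x + y) = s *: schur_sum_model x + schur_sum_model y.
Proof. by apply: model_linear => *; exact: coded_coef_linear. Qed.

Lemma schur_sum_model_mul x y : schur_sum_model (amul x y) =
  word_mul (place_words n d) (schur_sum_model x) (schur_sum_model y).
Proof.
apply: model_mul => [b|a b s f g w v|a b c g f w v].
- exact: coding_finite (fin_coset_coding b).
- exact: coded_coef_linear.
- exact: coded_coef_comp.
Qed.

Lemma schur_sum_model_invariant x :
  word_invariant d (place_words n d) (schur_sum_model x).
Proof.
apply: model_invariant => [s w|s w|b|a b s f g w v|a b f s w v].
- exact: place_words_perm.
- exact: word_composition_perm.
- exact: coding_finite (fin_coset_coding b).
- exact: coded_coef_linear.
- exact: coded_coef_perm.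
Qed.

Lemma schur_sum_model_surj F : word_invariant d (place_words n d) F ->
  exists x, schur_sum_model x = F.
Proof.
move=> FI; apply: model_surj FI => [a b s f g w v|a b G].
  exact: coded_coef_linear.
exact: coded_coef_surj.
Qed.

Lemma schur_sum_model_inj : injective schur_sum_model.
Proof.
move=> x y xy; apply/eqP; rewrite -subr_eq0; apply/eqP.
have /model_eq0 h : schur_sum_model (x - y) = 0.
  by rewrite addrC -scaleN1r schur_sum_model_linear xy scaleN1r addNr.
apply: val_inj; apply: functional_extensionality_dep => -[a b].
apply: (@coded_coef_eq0 _ _ _ _ _ _ _ _
  (fin_coset_coding a) (fin_coset_coding b)); exact: h.
Qed.

End FiniteCosetWords.

(** * The matrix model of the endomorphism algebra of the tensor power *)

Section SchurEnd.
Variables (k : fieldType) (m d : nat).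
Hypothesis m0 : (0 < m)%N.
Local Notation R := (place_words (Some m) d).
Local Notation c := (words_coding d m0).

Local Notation E := (equi_hom k (place_action m d) (place_action m d)).

(** With a single object there is no splitting by type, and entries outside [R] vanish because all
    codes lie in [R]. *)
Definition schur_end_model (f : E) : word_fun k :=
  fun wv => coded_coef c c f wv.1 wv.2.

Lemma schur_end_model_linear (s : k) (x y : E) :
  schur_end_model (s *: x + y) = s *: schur_end_model x + schur_end_model y.
Proof. by apply: funext => -[w v]; exact: (coded_coef_linear c c s x y w v). Qed.

Lemma schur_end_model_mul (x y : E) : schur_end_model (equi_comp x y) =
  word_mul R (schur_end_model x) (schur_end_model y).
Proof.
apply: funext => -[w v].
have [[Rw Rv]|nR] := pselect (R w /\ R v).
  exact: (coded_coef_comp c c c x y Rw Rv).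
rewrite [LHS]coded_coef_out//; apply/esym/fsbig1 => u Ru.
have [Rw|nRw] := pselect (R w).
  by rewrite {2}/schur_end_model coded_coef_out ?mulr0// => -[_ Rv]; exact: nR.
by rewrite {1}/schur_end_model coded_coef_out ?mul0r// => -[].
Qed.

Lemma schur_end_model_invariant x : word_invariant d R (schur_end_model x).
Proof.
have fR : finite_set R by exact: coding_finite c.
have out w v : schur_end_model x (w, v) != 0 -> R w /\ R v.
  by apply: contra_neqP => nR; exact: (coded_coef_out c c x nR).
split=> //; last first.
  by apply: sub_finite_set (finite_setX fR fR) => -[w v] /out.
move=> s w v; have [[Rw Rv]|nR] := pselect (R w /\ R v).
  exact: (coded_coef_perm c c x s Rw Rv).
rewrite [RHS]coded_coef_out// [LHS]coded_coef_out// => h; apply: nR.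
have RV u : R (u \o perm_nat s) -> R u.
  move=> /(place_words_perm s^-1%g); rewrite (_ : (u \o _) \o _ = u)//.
  by apply: funext => z /=; rewrite perm_natVK.
by case: h => /RV Rw /RV Rv.
Qed.

Lemma schur_end_model_surj F : word_invariant d R F ->
  exists x, schur_end_model x = F.
Proof.
move=> [Finv _ FR]; have [f fF] := coded_coef_surj (k := k) c c Finv.
exists f; apply: funext => -[w v].
have [[Rw Rv]|nR] := pselect (R w /\ R v); first exact: fF.
rewrite [LHS]coded_coef_out//; apply/esym/eqP/negPn/negP => /FR; exact: nR.
Qed.

Lemma schur_end_model_inj : injective schur_end_model.
Proof.
move=> x y xy; apply/eqP; rewrite -subr_eq0; apply/eqP.
apply: (@coded_coef_eq0 _ _ _ _ _ _ _ _ c c) => w v _ _.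
rewrite -[LHS]/(schur_end_model (x - y) (w, v)).
by rewrite addrC -scaleN1r schur_end_model_linear xy scaleN1r addNr.
Qed.

End SchurEnd.

Theorem theorem5p2p1 (k : fieldType) (char0 : [pchar k] =i pred0)
    (n : option nat) (n_gt0 : n <> Some 0%N) (d : nat) :
  exists (mul_bilinear : bilinear_product (@inf_schur_mul k n d%:R))
    (ideal : @two_sided_ideal k (inf_schur_algebra mul_bilinear)
               (@negligible_ideal k n d%:R)),
    algebra_iso (quotient_algebra ideal) (classical_schur k n d).
Proof.
(* Since n is not 0 the colour 1 is available, both for the infinite block and for the padding of
   words. *)
have n1 : in_range n 1 by case: n n_gt0 => [[|m]|].
have bil := inf_schur_mul_bilinear d%:R char0 n1.
exists bil, (negligible_two_sided n1 char0 bil).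
(* The classical algebra is an endomorphism algebra for finite n and a direct sum for infinite n,
   but each is modelled by the invariant matrices on [place_words]. *)
case: n n_gt0 n1 bil => [m _ n1 bil|_ n1 bil].
  have m0 : (0 < m)%N by [].
  apply: (@quotient_iso k (inf_schur_algebra bil) _
    (negligible_two_sided n1 char0 bil) (schur_end k m d) (word_fun k)
    (word_mul (place_words (Some m) d))
    (word_invariant d (place_words (Some m) d))
    (@inf_schur_model _ d n1 k) (schur_end_model m0)).
  - exact: inf_schur_model_linear.
  - exact: schur_end_model_linear.
  - exact: inf_schur_model_mul.
  - exact: schur_end_model_mul.
  - exact: inf_schur_model_invariant.
  - exact: inf_schur_model_surj.
  - exact: schur_end_model_invariant.
  - exact: schur_end_model_surj.
  - exact: negligible_idealP.
  - exact: schur_end_model_inj.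
apply: (@quotient_iso k (inf_schur_algebra bil) _
    (negligible_two_sided n1 char0 bil) (schur_sum k None d) (word_fun k)
  (word_mul (place_words None d))
  (word_invariant d (place_words None d))
  (@inf_schur_model _ d n1 k) (@schur_sum_model _ d n1 k)).
- exact: inf_schur_model_linear.
- exact: schur_sum_model_linear.
- exact: inf_schur_model_mul.
- exact: schur_sum_model_mul.
- exact: inf_schur_model_invariant.
- exact: inf_schur_model_surj.
- exact: schur_sum_model_invariant.
- exact: schur_sum_model_surj.
- exact: negligible_idealP.
- exact: schur_sum_model_inj.
Qed.
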